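(* Let $0<\alpha<1$ and consider the Hilbert matrix operator $\mathcal H:H^\infty_{w_\alpha}\to H^\infty_{w_\alpha}$. Then $$\|\mathcal H\|_{H^\infty_{w_\alpha}\to H^\infty_{w_\alpha}}=\|\mathcal H\|_{e,H^\infty_{w_\alpha}\to H^\infty_{w_\alpha}}=\frac{\pi}{\sin(\alpha\pi)} .$$
   Context: $\mathbb D$ is the open unit disk, $w_\alpha(z)=(1-|z|)^\alpha$, and $H^\infty_{w_\alpha}$ is the Banach space of analytic $f$ on $\mathbb D$ with $\|f\|_{H^\infty_{w_\alpha}}=\sup_{z\in\mathbb D}|f(z)|(1-|z|)^\alpha<\infty$. The Hilbert matrix operator is $\mathcal H(f)(z)=\int_0^1\frac{f(x)}{1-zx}\,dx$. Essential norm: $\|T\|_{e,X\to X}=\inf\{\|T-L\|_{X\to X}:L:X\to X\text{ compact}\}$. *)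

(* Defs.v *)
From HB Require Import structures.
From mathcomp Require Import all_boot all_order all_algebra.
From mathcomp Require Import complex.
From mathcomp Require Import all_classical all_reals all_analysis.

Set Implicit Arguments.
Unset Strict Implicit.
Unset Printing Implicit Defensive.

Import Order.TTheory GRing.Theory Num.Theory.
Import numFieldNormedType.Exports.
Import ComplexField.Normc.

Local Open Scope classical_set_scope.
Local Open Scope ring_scope.
Local Open Scope complex_scope.

Section WeightedSpace.
Variables (R : realType) (alpha : R).

(* [normc z : R] is the modulus; [`|z| : R[i]] is the same number seen in
   [R[i]].  The codomain [R[i]^o] selects the structure of [R[i]] as a vector
   space over itself (by default, [R[i]] is a module over [R]). *)

Definition disk : set R[i] := [set z | normc z < 1].

(* Complex differentiability: in [derivable], the increment tends to 0 in
   the scalar field, which is [R[i]] here. *)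
Definition analytic_on_disk (f : R[i] -> R[i]^o) : Prop :=
  forall z, disk z -> derivable (f : R[i]^o -> R[i]^o) z 1.

Definition weight (z : R[i]) : R := (1 - normc z) `^ alpha.

Definition weighted_values (f : R[i] -> R[i]^o) : set R :=
  [set normc (f z) * weight z | z in disk].

(* Functions on the disk are represented by their extension by 0, so that two
   elements of the space are equal exactly when they agree on the disk. *)
Definition Hinf_pred : {pred R[i] -> R[i]^o} :=
  [pred f | `[< [/\ analytic_on_disk f,
                    has_ubound (weighted_values f)
                  & forall z, ~ disk z -> f z = 0] >] ].

Record Hinf := MkHinf {
  Hinf_val :> R[i] -> R[i]^o;
  Hinf_valP : Hinf_val \in Hinf_pred }.

HB.instance Definition _ := [isSub for Hinf_val].
HB.instance Definition _ := [Choice of Hinf by <:].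

Lemma weight_ge0 z : 0 <= weight z. Proof. exact: powR_ge0. Qed.

Lemma weight_gt0 z : disk z -> 0 < weight z.
Proof. by move=> zD; rewrite powR_gt0 // subr_gt0. Qed.

Lemma normcR_ge0 (z : R[i]) : 0 <= normc z.
Proof. by case: z => a b; exact: sqrtr_ge0. Qed.

Lemma disk0 : disk 0.
Proof. by rewrite /disk /= [X in X < _](_ : _ = 0) ?ltr01 //; exact: normc0. Qed.

Lemma Hinf_submod_closed : submod_closed Hinf_pred.
Proof.
split=> [|a f g /asboolP[fa [M fM] f0] /asboolP[ga [N gN] g0]]; apply/asboolP; split.
- by move=> z _; exact: derivable_cst.
- by exists 0 => _ [z _ <-]; rewrite [X in X * _](_ : _ = 0) ?mul0r //; exact: normc0.
- by [].
- move=> z zD; apply: derivableD; last exact: ga.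
  by apply: derivableZ; exact: fa.
- exists (normc a * M + N) => _ [z zD <-].
  have fz : normc (f z) * weight z <= M by apply: fM; exists z.
  have gz : normc (g z) * weight z <= N by apply: gN; exists z.
  apply: le_trans (lerD (ler_wpM2l _ fz) gz); last exact: normcR_ge0.
  rewrite mulrA -mulrDl ler_wpM2r ?weight_ge0 // -normcM.
  exact: le_normcD.
- move=> z zD; change (a * f z + g z = 0).
  by rewrite f0 // g0 // mulr0 addr0.
Qed.

HB.instance Definition _ :=
  GRing.isSubmodClosed.Build R[i] (R[i] -> R[i]^o) Hinf_pred Hinf_submod_closed.
HB.instance Definition _ := [SubChoice_isSubLmodule of Hinf by <:].

Definition Hinf_norm (f : Hinf) : R := sup (weighted_values f).


Lemma weighted_values_ub (f : Hinf) : has_ubound (weighted_values f).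
Proof. by case: f => f /= /asboolP[]. Qed.

Lemma weighted_values_sup (f : Hinf) : has_sup (weighted_values f).
Proof.
split; last exact: weighted_values_ub.
by exists (normc (f 0) * weight 0); exists 0 => //; exact: disk0.
Qed.

Lemma Hinf_norm_ub (f : Hinf) z :
  disk z -> normc (f z) * weight z <= Hinf_norm f.
Proof.
by move=> zD; apply: (ub_le_sup (weighted_values_ub f)); exists z.
Qed.

Lemma Hinf_norm_le (f : Hinf) M :
  (forall z, disk z -> normc (f z) * weight z <= M) -> Hinf_norm f <= M.
Proof.
move=> fM; apply: ge_sup; first by case: (weighted_values_sup f).
by move=> _ [z zD <-]; exact: fM.
Qed.

Lemma Hinf_norm_ge0 (f : Hinf) : 0 <= Hinf_norm f.
Proof.
apply: le_trans (Hinf_norm_ub f disk0).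
by rewrite mulr_ge0 ?weight_ge0 ?normcR_ge0.
Qed.

Lemma Hinf_ext (f g : Hinf) : (forall z, disk z -> f z = g z) -> f = g.
Proof.
move=> fg; apply/val_inj/funext => z /=.
have [/fg //|zD] := pselect (disk z).
case: f g {fg} => f /= /asboolP[_ _ f0] [g /= /asboolP[_ _ g0]].
by rewrite f0 // g0.
Qed.

Lemma Hinf_norm_triangle (f g : Hinf) :
  Hinf_norm (f + g) <= Hinf_norm f + Hinf_norm g.
Proof.
apply: Hinf_norm_le => z zD.
apply: le_trans (lerD (Hinf_norm_ub f zD) (Hinf_norm_ub g zD)).
by rewrite -mulrDl ler_wpM2r ?weight_ge0 //; exact: le_normcD.
Qed.

Lemma Hinf_normZ_le (a : R[i]) (f : Hinf) :
  Hinf_norm (a *: f) <= normc a * Hinf_norm f.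
Proof.
apply: Hinf_norm_le => z zD; rewrite [X in X * _](_ : _ = normc a * normc (f z)).
  by rewrite -mulrA ler_wpM2l ?normcR_ge0 ?Hinf_norm_ub.
exact: normcM.
Qed.

Lemma Hinf_normZ (a : R[i]) (f : Hinf) :
  Hinf_norm (a *: f) = normc a * Hinf_norm f.
Proof.
apply/le_anti; rewrite Hinf_normZ_le /=.
have [->|a0] := eqVneq a 0.
  by rewrite [X in X * _](_ : _ = 0) ?mul0r ?Hinf_norm_ge0 //; exact: normc0.
have na0 : 0 < normc a.
  by rewrite lt_def normcR_ge0 andbT; apply: contra_neq a0 => /eq0_normc.
rewrite -ler_pdivlMl // -normcV.
by rewrite -[X in Hinf_norm X <= _](scalerK a0) Hinf_normZ_le.
Qed.

Lemma Hinf_norm_eq0 (f : Hinf) : Hinf_norm f = 0 -> f = 0.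
Proof.
move=> f0; apply: Hinf_ext => z zD; apply: eq0_normc; apply/le_anti.
rewrite normcR_ge0 andbT -(ler_pM2r (weight_gt0 zD)) mul0r -f0.
exact: Hinf_norm_ub.
Qed.

(* Norms of normed modules over [R[i]] take values in [R[i]]. *)
Definition Hinf_normC (f : Hinf) : R[i] := (Hinf_norm f)%:C.

Lemma Hinf_normC_triangle (f g : Hinf) :
  Hinf_normC (f + g) <= Hinf_normC f + Hinf_normC g.
Proof. by rewrite /Hinf_normC -rmorphD /= lecR Hinf_norm_triangle. Qed.

Lemma Hinf_normCZ (a : R[i]) (f : Hinf) :
  Hinf_normC (a *: f) = `|a| * Hinf_normC f.
Proof. by rewrite /Hinf_normC Hinf_normZ rmorphM. Qed.

Lemma Hinf_normC_eq0 (f : Hinf) : Hinf_normC f = 0 -> f = 0.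
Proof. by move=> [/Hinf_norm_eq0]. Qed.

HB.instance Definition _ := Lmodule_isNormed.Build R[i] Hinf
  Hinf_normC_triangle Hinf_normCZ Hinf_normC_eq0.

End WeightedSpace.

Section Operators.
Variables (R : realType) (V W : normedModType R[i]).

(* The values are extended reals, so that the norm of an unbounded operator
   is [+oo].  [complex.Re] turns the [R[i]]-valued norm into a number in [R]. *)
Definition op_norm (T : V -> W) : \bar R :=
  ereal_sup [set (complex.Re `|T f|)%:E | f in [set f : V | `|f| <= 1]].

Definition compact_operator (L : {linear V -> W}) : Prop :=
  precompact [set L f | f in [set f : V | `|f| <= 1]].

Definition essential_norm (T : V -> W) : \bar R :=
  ereal_inf [set op_norm (fun f => T f - L f)
            | L in [set L : {linear V -> W} | compact_operator L]].

End Operators.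

Section HilbertMatrix.
Variable R : realType.

Definition complex_integral (a b : R) (g : R -> R[i]) : R[i] :=
  (\int[lebesgue_measure]_(x in `[a, b]) complex.Re (g x)) +i*
  (\int[lebesgue_measure]_(x in `[a, b]) complex.Im (g x)).

Definition hilbert_integral (f : R[i] -> R[i]) (z : R[i]) : R[i] :=
  complex_integral 0 1 (fun x => f x%:C / (1 - z * x%:C)).

Definition hilbert_function (f : R[i] -> R[i]) (z : R[i]) : R[i]^o :=
  if normc z < 1 then hilbert_integral f z else 0.

(* [insubd] packs the function as an element of the space, with default value
   0 if it did not belong to it; the statement therefore asserts the integral
   formula, which says that this default is harmless. *)
Definition hilbert_operator (alpha : R) (f : Hinf alpha) : Hinf alpha :=
  insubd (0 : Hinf alpha) (hilbert_function f).

End HilbertMatrix.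

(* Main.v *)
(* On the real axis [|f x| <= ||f|| (1 - x)^(-alpha)], and [|1 - z x| >= 1 - |z| x],
   so with [r = |z|] everything reduces to
     [K r = (1 - r)^alpha * int_0^1 (1 - x)^(-alpha) / (1 - r x) dx].
   The substitution [p = r (1 - x) / (1 - r)] gives [K r = r^(alpha - 1) T (r / (1 - r))]
   with [T t = int_0^t p^(-alpha) / (1 + p) dp]; this increases with [r], and its limit
   [T oo] is the sum of the alternating series [sum_n (-1)^n / (n + alpha)] over all
   integers [n], which is [pi / sin (alpha pi)] by the behaviour of the Dirichlet kernel.
   For the lower bound, cut the power series of [(1 - z)^(-alpha)], whose coefficients
   are positive, into consecutive blocks [f_j].  Any sum of distinct blocks has norm at
   most 1, and each block can be made long enough for [||H f_j||] to be as close to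
   [pi / sin (alpha pi)] as desired.  If [L] is compact, then [L f_j] has a cluster
   point [g]; the sums of [m] blocks with [L f_j] close to [g] stay in the unit ball while
   their images grow like [m ||g||], so [g = 0].  Hence [||H - L||] is no smaller. *)
Require Import Defs.
From mathcomp Require Import all_boot all_order all_algebra.
From mathcomp Require Import complex.
From mathcomp Require Import all_classical all_reals all_analysis.
From mathcomp Require Import measurable_realfun ring lra.

Set Implicit Arguments.
Unset Strict Implicit.
Unset Printing Implicit Defensive.

Import Order.TTheory GRing.Theory Num.Theory.
Import numFieldNormedType.Exports.
Import ComplexField.Normc.
Local Open Scope classical_set_scope.
Local Open Scope ring_scope.

(** * Differentiation on an interval *)

(** The integrands are singular at an endpoint and a limit occurs at every stage. The estimates of
    [T] are therefore made on antiderivatives: a comparison of derivatives replaces a bound under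
    the integral sign, and limits appear as explicit error bounds. The part of [T] over [1, oo) is
    folded onto [0, 1] by p -> 1/p; the two halves then expand into the terms n >= 0 and n < 0 of
    the bilateral series. A single test function would settle the norm but not the essential norm,
    since a compact operator may cancel its image; hence the blocks. Removing the head of the series
    costs little: the head is a polynomial, and its image grows too slowly near 1 to survive the
    weight. Strong cluster points of sums of blocks take the place of weak convergence, so no
    description of the dual space is needed. *)

Section Calculus.
Variable R : realType.
Implicit Types (f g h : R -> R) (x a b : R).

(* The library states these rules for [f + g], [f * g] and so on as elements of
   a function space, which do not unify with lambda-abstractions. *)
Lemma is_deriveD_fun f g x a b : is_derive x 1 f a -> is_derive x 1 g b ->
  is_derive x 1 (fun y => f y + g y) (a + b).
Proof. exact: is_deriveD. Qed.

Lemma is_deriveB_fun f g x a b : is_derive x 1 f a -> is_derive x 1 g b ->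
  is_derive x 1 (fun y => f y - g y) (a - b).
Proof. exact: is_deriveB. Qed.

Lemma is_deriveN_fun f x a : is_derive x 1 f a ->
  is_derive x 1 (fun y => - f y) (- a).
Proof. exact: is_deriveN. Qed.

Lemma is_deriveM_fun f g x a b : is_derive x 1 f a -> is_derive x 1 g b ->
  is_derive x 1 (fun y => f y * g y) (a * g x + f x * b).
Proof.
move=> fa gb.
have -> : a * g x + f x * b = f x *: b + g x *: a.
  by rewrite addrC /GRing.scale /= (mulrC (g x)).
exact: is_deriveM.
Qed.

Lemma is_derive_linear (c x : R) : is_derive x 1 (fun y : R => c * y) c.
Proof.
have := is_deriveM_fun (is_derive_cst c x 1) (is_derive_id x 1).
by rewrite mul0r add0r mulr1.
Qed.

Lemma is_deriveMl_fun (c : R) f x a : is_derive x 1 f a ->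
  is_derive x 1 (fun y => c * f y) (c * a).
Proof.
move=> fa; have := is_deriveM_fun (is_derive_cst c x 1) fa.
by rewrite mul0r add0r.
Qed.

Lemma is_derive_comp_fun f g x a b : is_derive (g x) 1 f a ->
  is_derive x 1 g b -> is_derive x 1 (fun y => f (g y)) (a * b).
Proof. by exact: is_derive1_comp. Qed.

Lemma is_derive_onem x : is_derive x 1 (fun y : R => 1 - y) (-1).
Proof.
have := is_deriveB_fun (is_derive_cst (1 : R) x 1) (is_derive_id x 1).
by rewrite sub0r.
Qed.

Lemma is_derive_denom (r x : R) : is_derive x 1 (fun y : R => 1 - r * y) (- r).
Proof.
have := is_deriveB_fun (is_derive_cst (1 : R) x 1) (is_derive_linear r x).
by rewrite sub0r.
Qed.

Lemma is_deriveV_fun f x a : f x != 0 -> is_derive x 1 f a ->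
  is_derive x 1 (fun y => (f y)^-1) (- a / f x ^+ 2).
Proof.
move=> fx fa.
have -> : - a / f x ^+ 2 = - (f x) ^- 2 *: a.
  by rewrite /GRing.scale/= !mulNr mulrC.
exact: is_deriveV.
Qed.

Lemma is_derive_sum_fun n (h dh : nat -> R -> R) x :
  (forall i, (i < n)%N -> is_derive x 1 (h i) (dh i x)) ->
  is_derive x 1 (fun y => \sum_(i < n) h i y) (\sum_(i < n) dh i x).
Proof.
elim: n => [_|n IH H].
  rewrite big_ord0 (_ : (fun _ => _) = cst 0); first exact: is_derive_cst.
  by apply/funext => y; rewrite big_ord0.
rewrite (_ : (fun _ => _) = (fun y => (\sum_(i < n) h i y) + h n y)); last first.
  by apply/funext => y; rewrite big_ord_recr.
rewrite big_ord_recr /=; apply: is_deriveD_fun; last exact: H.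
by apply: IH => i ni; apply: H; rewrite ltnS ltnW.
Qed.

Lemma is_derive_continuous f x a : is_derive x 1 f a -> {for x, continuous f}.
Proof. by move=> fa; apply/differentiable_continuous/derivable1_diffP. Qed.

(* Continuity at [a] is one-sided only, so that [f] may be singular there. *)
Lemma continuous_itv_derive f df a b : (a < b)%R ->
  f @ a^'+ --> f a -> (forall x, a < x <= b -> is_derive x 1 f (df x)) ->
  {within `[a, b], continuous f}.
Proof.
move=> ab fa dfx; apply/continuous_within_itvP => //; split => //.
  move=> x; rewrite in_itv /= => /andP[ax xb].
  by apply: (@is_derive_continuous _ _ (df x)); apply: dfx; rewrite ax ltW.
apply: cvg_at_left_filter; apply: (@is_derive_continuous _ _ (df b)).
by apply: dfx; rewrite ab lexx.
Qed.

(** The mean value theorem applied to [g + f] and [g - f], whose derivatives are nonnegative. It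
    plays the role of the bound of |int df| by int dg, without any integrability to check. *)
Lemma derive_dist_le f g df dg a b : a <= b ->
  {within `[a, b], continuous f} -> {within `[a, b], continuous g} ->
  (forall x, a < x < b -> is_derive x 1 f (df x)) ->
  (forall x, a < x < b -> is_derive x 1 g (dg x)) ->
  (forall x, a < x < b -> `|df x| <= dg x) ->
  `|f b - f a| <= g b - g a.
Proof.
rewrite le_eqVlt => /predU1P[<- *|ab cf cg Df Dg dfg].
  by rewrite !subrr normr0.
have cgDf : {within `[a, b], continuous (g + f)}.
  by move=> x; apply: continuousD; [exact: cg|exact: cf].
have cgBf : {within `[a, b], continuous (g - f)}.
  by move=> x; apply: continuousD; [exact: cg|apply: continuousN; exact: cf].
have [] := @MVT R _ (fun x => dg x + df x) _ _ ab _ cgDf.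
  by move=> x xab; apply: is_deriveD_fun; [apply: Dg|apply: Df].
move=> c cab /= cE.
have [] := @MVT R _ (fun x => dg x - df x) _ _ ab _ cgBf.
  by move=> x xab; apply: is_deriveB_fun; [apply: Dg|apply: Df].
move=> d dab /= dE.
move: (dfg _ cab) (dfg _ dab); rewrite !ler_norml => /andP[c1 _] /andP[_ d2].
have ba : 0 <= b - a by rewrite subr_ge0 ltW.
have E1 : (g + f) b - (g + f) a = (g b - g a) + (f b - f a).
  by rewrite !fctE; ring.
have E2 : (g - f) b - (g - f) a = (g b - g a) - (f b - f a).
  by rewrite !fctE; ring.
have H1 : 0 <= (g b - g a) + (f b - f a).
  by rewrite -E1 cE mulr_ge0 // -lerBlDl sub0r.
have H2 : 0 <= (g b - g a) - (f b - f a).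
  by rewrite -E2 dE mulr_ge0 // subr_ge0.
by apply/andP; split; lra.
Qed.

Lemma derive_ge0_le f df a b : a <= b -> {within `[a, b], continuous f} ->
  (forall x, a < x < b -> is_derive x 1 f (df x)) ->
  (forall x, a < x < b -> 0 <= df x) -> f a <= f b.
Proof.
move=> ab cf Df df0; rewrite -subr_ge0.
have c0 : {within `[a, b], continuous (cst 0 : R -> R)}.
  by move=> x; exact: cvg_cst.
apply: le_trans (@derive_dist_le _ _ (cst 0) df _ _ ab c0 cf _ Df _); first exact: normr_ge0.
by move=> x xab; rewrite normr0 df0.
Qed.

End Calculus.

(** * Partial fractions of the cosecant *)

Section Cosecant.
Variables (R : realType) (alpha : R).
Hypothesis halpha : 0 < alpha < 1.
Implicit Types (x : R) (N : nat).

Lemma sin_sub (x y : R) :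
  sin (x + y) - sin (x - y) = 2 * cos x * sin y.
Proof. rewrite sinD sinB; ring. Qed.

Lemma dirichlet_kernel N x :
  sin (x / 2) * (1 + 2 * \sum_(i < N) cos (i.+1%:R * x)) =
  sin ((N%:R + 2^-1) * x).
Proof.
elim: N => [|N IH].
  by rewrite big_ord0 mulr0 addr0 mulr1 add0r mulrC.
rewrite big_ord_recr /= (mulrDr 2) addrA mulrDr IH.
have -> : (N.+1%:R + 2^-1) * x = N.+1%:R * x + x / 2 by field.
have -> : (N%:R + 2^-1) * x = N.+1%:R * x - x / 2.
  by rewrite -natr1; field.
by have := sin_sub (N.+1%:R * x) (x / 2); lra.
Qed.

(** Symmetric partial sum, over |n| <= N, of the series of (-1)^n / (alpha + n), with the terms n
    and -n paired. *)
Definition csc_sum N : R := alpha^-1 +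
  \sum_(i < N) (-1) ^+ i.+1 * ((alpha + i.+1%:R)^-1 + (alpha - i.+1%:R)^-1).

(** Since 1 - cos (alpha x) = 2 sin (alpha x / 2)^2, the product of 1 - cos (alpha x) with the
    Dirichlet kernel is 2 g(x) sin ((N + 1/2) x). The factor 1 - cos (alpha x) is there to cancel
    the zero of sin (x / 2) at 0. *)
Let g x : R := sin (alpha * x / 2) ^+ 2 / sin (x / 2).

Let dg x : R := (alpha * sin (alpha * x / 2) * cos (alpha * x / 2) * sin (x / 2)
  - 2^-1 * sin (alpha * x / 2) ^+ 2 * cos (x / 2)) / sin (x / 2) ^+ 2.

Let sin_half_gt0 x : 0 < x <= pi -> 0 < sin (x / 2).
Proof.
move=> /andP[x0 xpi]; apply: sin_gt0_pi; rewrite divr_gt0 //=.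
have := pi_gt0 R; lra.
Qed.

Let sin_le x : 0 < x <= pi -> 0 <= sin (alpha * x / 2) <= sin (x / 2).
Proof.
move=> /andP[x0 xpi]; have p0 := pi_gt0 R; case/andP: halpha => a0 a1.
have ax0 : 0 < alpha * x by rewrite mulr_gt0.
have axx : alpha * x < x by rewrite gtr_pMl.
apply/andP; split.
  by apply: sin_ge0_pi; apply/andP; split; lra.
apply/ltW; rewrite ltr_sin ?in_itv /=; lra.
Qed.

Let g_le1 x : 0 < x <= pi -> `|g x| <= sin (alpha * x / 2).
Proof.
move=> xpi; have /andP[s0 s1] := sin_le xpi; have s2 := sin_half_gt0 xpi.
rewrite /g ger0_norm; last by rewrite divr_ge0 ?sqr_ge0 // ltW.
by rewrite ler_pdivrMr // expr2 ler_wpM2l.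
Qed.

(** As 0 <= sin (alpha x / 2) <= sin (x / 2), each of the two terms of the numerator is at most sin
    (x / 2)^2. The bound thus holds uniformly up to the singular point 0. *)
Let dg_le x : 0 < x <= pi -> `|dg x| <= 2.
Proof.
move=> xpi; have /andP[s0 s1] := sin_le xpi; have s2 := sin_half_gt0 xpi.
case/andP: halpha => a0 a1.
rewrite /dg normrM normfV (ger0_norm (sqr_ge0 _)) ler_pdivrMr ?exprn_gt0 //.
set u := sin (alpha * x / 2) in s0 s1 *; set v := sin (x / 2) in s1 s2 *.
apply: le_trans (ler_normB _ _) _; rewrite !normrM.
rewrite (gtr0_norm a0) (ger0_norm s0) (gtr0_norm s2).
have -> : `|2^-1 : R| = 2^-1 by rewrite ger0_norm.
have c1 := cos_max (alpha * x / 2); have c2 := cos_max (x / 2).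
have n1 := normr_ge0 (cos (alpha * x / 2)); have n2 := normr_ge0 (cos (x / 2)).
set p := `|cos _| in c1 n1 *; set q := `|cos _| in c2 n2 *.
have H1 : alpha * u * p * v <= v ^+ 2.
  rewrite expr2 ler_wpM2r ?(ltW s2) //.
  by apply: le_trans s1; rewrite mulrAC ler_piMl ?mulr_ile1 ?(ltW a0) ?(ltW a1).
have H2 : 2^-1 * u ^+ 2 * q <= v ^+ 2 by nra.
by lra.
Qed.

Let is_derive_g x : 0 < x <= pi -> is_derive x 1 g (dg x).
Proof.
move=> /sin_half_gt0 s0.
have Dl (c : R) : is_derive x 1 (fun y => sin (c * y / 2)) (cos (c * x / 2) * (c / 2)).
  apply: (is_derive_comp_fun (is_derive_sin _)).
  rewrite (_ : (fun _ => _) = *%R (c / 2)); first exact: is_derive_linear.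
  by apply/funext => y; rewrite mulrAC.
have D2 : is_derive x 1 (fun y : R => sin (y / 2)) (cos (x / 2) / 2).
  have := Dl 1; rewrite !mul1r; congr (is_derive _ _ _ _).
  by apply/funext => y; rewrite mul1r.
have s0' : sin (x / 2) != 0 by rewrite gt_eqF.
have := is_deriveM_fun (is_deriveM_fun (Dl alpha) (Dl alpha)) (is_deriveV_fun s0' D2).
by congr (is_derive _ _ _ _); rewrite /dg; field.
Qed.

(* The antiderivative of [(1 - cos (alpha x)) D_N x], where [D_N] is the
   Dirichlet kernel. *)
Let P N x : R := x + 2 * (\sum_(i < N) sin (i.+1%:R * x) / i.+1%:R)
  - sin (alpha * x) / alpha
  - \sum_(i < N) (sin ((alpha + i.+1%:R) * x) / (alpha + i.+1%:R)
               + sin ((alpha - i.+1%:R) * x) / (alpha - i.+1%:R)).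

Let dP N x : R := (1 - cos (alpha * x)) * (1 + 2 * \sum_(i < N) cos (i.+1%:R * x)).

(* The added term is the boundary term of an integration by parts; it makes
   the derivative [dPsi] of order [1 / N]. *)
Let Psi N x : R := P N x
  + 2 / (N%:R + 2^-1) * (g x * cos ((N%:R + 2^-1) * x)).

Let dPsi N x : R := 2 / (N%:R + 2^-1) * (dg x * cos ((N%:R + 2^-1) * x)).

Let is_derive_sin_scale (c x : R) : c != 0 ->
  is_derive x 1 (fun y => sin (c * y) / c) (cos (c * x)).
Proof.
move=> c0.
have := is_deriveMl_fun c^-1
  (is_derive_comp_fun (is_derive_sin (c * x)) (is_derive_linear c x)).
rewrite [c^-1 * _]mulrC mulfK //; congr (is_derive _ _ _ _).
by apply/funext => y; rewrite mulrC.
Qed.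

Let alpha_nat_neq0 n : (alpha + n.+1%:R != 0) * (alpha - n.+1%:R != 0).
Proof.
case/andP: halpha => a0 a1; have n1 : 1 <= n.+1%:R :> R by rewrite ler1n.
by split; [rewrite gt_eqF //|rewrite lt_eqF //]; lra.
Qed.

Let is_derive_P N x : is_derive x 1 (P N) (dP N x).
Proof.
have a0' : alpha != 0 by case/andP: halpha => a0 _; rewrite gt_eqF.
have Dsum1 : is_derive x 1 (fun y => \sum_(i < N) sin (i.+1%:R * y) / i.+1%:R)
    (\sum_(i < N) cos (i.+1%:R * x)).
  apply: (is_derive_sum_fun (h := fun i y => sin (i.+1%:R * y) / i.+1%:R)
    (dh := fun i y => cos (i.+1%:R * y))) => i _.
  by apply: is_derive_sin_scale; rewrite pnatr_eq0.
have Dsum2 : is_derive x 1 (fun y => \sum_(i < N)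
    (sin ((alpha + i.+1%:R) * y) / (alpha + i.+1%:R)
     + sin ((alpha - i.+1%:R) * y) / (alpha - i.+1%:R)))
    (\sum_(i < N) (2 * cos (alpha * x) * cos (i.+1%:R * x))).
  apply: (is_derive_sum_fun (h := fun i y =>
    (sin ((alpha + i.+1%:R) * y) / (alpha + i.+1%:R)
     + sin ((alpha - i.+1%:R) * y) / (alpha - i.+1%:R)))
    (dh := fun i y => 2 * cos (alpha * y) * cos (i.+1%:R * y))) => i _.
  have -> : 2 * cos (alpha * x) * cos (i.+1%:R * x) =
      cos ((alpha + i.+1%:R) * x) + cos ((alpha - i.+1%:R) * x).
    by rewrite (mulrDl alpha) mulrBl cosD cosB; ring.
  by apply: is_deriveD_fun; apply: is_derive_sin_scale; rewrite alpha_nat_neq0.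
have := is_deriveB_fun (is_deriveB_fun (is_deriveD_fun
  (is_derive_id x 1) (is_deriveMl_fun 2 Dsum1)) (is_derive_sin_scale x a0'))
  Dsum2.
by congr (is_derive _ _ _ _); rewrite -mulr_sumr /dP; ring.
Qed.

Let is_derive_Psi N x : 0 < x <= pi -> is_derive x 1 (Psi N) (dPsi N x).
Proof.
move=> xpi; have s0 := sin_half_gt0 xpi.
have nu0 : N%:R + 2^-1 != 0 :> R by rewrite gt_eqF // ltr_wpDl.
have Dcos : is_derive x 1 (fun y => cos ((N%:R + 2^-1) * y))
    (- sin ((N%:R + 2^-1) * x) * (N%:R + 2^-1)).
  exact: is_derive_comp_fun (is_derive_cos _) (is_derive_linear _ x).
have := is_deriveD_fun (is_derive_P N x)
  (is_deriveMl_fun (2 / (N%:R + 2^-1)) (is_deriveM_fun (is_derive_g xpi) Dcos)).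
congr (is_derive _ _ _ _); rewrite /dP /dPsi; have := dirichlet_kernel N x.
set D := \sum_(i < N) _; set S := sin ((N%:R + 2^-1) * x) => <-.
have cosE : cos (alpha * x) = 1 - 2 * sin (alpha * x / 2) ^+ 2.
  rewrite [in LHS](_ : alpha * x = (alpha * x / 2) *+ 2); last by field.
  by rewrite cos_mulr2n cos2sin2; ring.
rewrite cosE /g; field.
by rewrite (gt_eqF s0) gt_eqF // addr_gt0_lt // mulr_ge0.
Qed.

Let continuous_Psi N : {within `[0, pi], continuous (Psi N)}.
Proof.
apply: (continuous_itv_derive (pi_gt0 R)); last exact: is_derive_Psi.
have s0 : sin (alpha / 2 * x) @[x --> 0^'+] --> 0.
  apply: cvg_at_right_filter.
  have := is_derive_continuous (is_derive_comp_fun (is_derive_sin (alpha / 2 * 0))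
    (is_derive_linear (alpha / 2) 0)).
  by rewrite /prop_for /continuous_at mulr0 sin0.
(* [g 0] is 0 because the numerator vanishes; the limit is 0 by squeezing between plus and minus sin
   (alpha x / 2). *)
have gc : g x @[x --> 0^'+] --> g 0.
  rewrite {2}/g mulr0 mul0r sin0 expr0n /= mul0r.
  have sN : - sin (alpha / 2 * x) @[x --> 0^'+] --> 0.
    by have := cvgN s0; rewrite oppr0; exact.
  apply: squeeze_cvgr sN s0; near=> x.
  rewrite -ler_norml mulrAC; apply: g_le1.
  by apply/andP; split; near: x; [exact: nbhs_right_gt|exact: nbhs_right_le (pi_gt0 R)].
rewrite /Psi; apply: cvgD.
  exact/cvg_at_right_filter/(is_derive_continuous (is_derive_P N 0)).
apply: cvgM; first exact: cvg_cst.
apply: cvgM => //; apply: cvg_at_right_filter.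
exact: (is_derive_continuous (is_derive_comp_fun (is_derive_cos _) (is_derive_linear _ _))).
Unshelve. all: by end_near. Qed.

Let sin_natpi n (c : R) : sin (c + n%:R * pi) = (-1) ^+ n * sin c.
Proof. by rewrite mulr_natl (alternatingn (@sinDpi R)). Qed.

(** [Psi N] vanishes at 0, and at pi it is the quantity to bound plus a boundary term, because sin
    ((alpha + k) pi) = (-1)^k sin (alpha pi) for every integer k. With nu = N + 1/2, the boundary
    term accounts for 2 / nu, and the derivative, at most 4 / nu on an interval of length pi, for 4
    pi / nu. *)
Lemma csc_sum_dist N :
  `|pi - sin (alpha * pi) * csc_sum N| <= (2 + 4 * pi) / (N%:R + 2^-1).
Proof.
have p0 := pi_gt0 R; case/andP: (halpha) => a0 a1.
have nu0 : 0 < N%:R + 2^-1 :> R by rewrite ltr_wpDl.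
set nu := N%:R + 2^-1 in nu0 *.
have Psi0 : Psi N 0 = 0.
  have g0 : g 0 = 0 by rewrite /g mulr0 mul0r sin0 expr0n /= mul0r.
  rewrite /Psi /P g0 !mulr0 sin0 !mul0r !big1 ?mulr0 ?subrr ?addr0 ?subr0 //.
  - by move=> i _; rewrite !mulr0 sin0 !mul0r addr0.
  - by move=> i _; rewrite mulr0 sin0 mul0r.
have Psipi : Psi N pi = pi - sin (alpha * pi) * csc_sum N
    + 2 / nu * (g pi * cos (nu * pi)).
  rewrite /Psi /P /csc_sum [X in 2 * X]big1 ?mulr0 ?addr0; last first.
    by move=> i _; rewrite -[_ * pi]add0r sin_natpi sin0 mulr0 mul0r.
  rewrite (mulrDr (sin (alpha * pi)) alpha^-1) opprD addrA; congr (_ - _ - _ + _).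
  rewrite mulr_sumr; apply: eq_bigr => i _.
  have sE := sin_natpi i.+1 (alpha * pi).
  rewrite (mulrDl alpha) sE.
  have -> : sin ((alpha - i.+1%:R) * pi) = (-1) ^+ i.+1 * sin (alpha * pi).
    rewrite mulrBl -[X in sin X = _]mul1r -(signrMK i.+1 (sin _)).
    by rewrite -sin_natpi mul1r subrK.
  move: (i.+1%:R) (alpha_nat_neq0 i) => n [n1 n2].
  by field; rewrite n1 n2.
have : `|Psi N pi - Psi N 0| <= 4 / nu * pi - 4 / nu * 0.
  apply: (@derive_dist_le _ _ ( *%R (4 / nu)) (dPsi N) (cst (4 / nu))) => //.
  - exact: ltW.
  - by apply: (@continuous_itv_derive _ _ (cst (4 / nu))) => // [|x _];
      [apply: cvg_at_right_filter; exact: mulrl_continuous|exact: is_derive_linear].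
  - by move=> x /andP[x0 xp]; apply: is_derive_Psi; rewrite x0 ltW.
  - by move=> x _; exact: is_derive_linear.
  - move=> x /andP[x0 xp]; rewrite /dPsi -/nu normrM gtr0_norm ?divr_gt0 //.
    rewrite (_ : 4 / nu = 2 / nu * 2); last by field; rewrite gt_eqF.
    rewrite ler_pM2l ?divr_gt0 // normrM -[leRHS]mulr1.
    by rewrite ler_pM // ?dg_le ?cos_max // x0 ltW.
rewrite Psi0 Psipi mulr0 !subr0.
have gpi : `|g pi * cos (nu * pi)| <= 1.
  rewrite normrM mulr_ile1 ?normr_ge0 ?cos_max //.
  by apply: le_trans (g_le1 _) (sin_le1 _); rewrite p0 lexx.
set A := pi - _ => H.
have -> : A = (A + 2 / nu * (g pi * cos (nu * pi))) - 2 / nu * (g pi * cos (nu * pi)).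
  by ring.
apply: le_trans (ler_normB _ _) _.
rewrite (mulrDl 2) [leRHS]addrC (_ : 4 * pi / nu = 4 / nu * pi); last by rewrite mulrAC.
apply: lerD => //.
by rewrite normrM gtr0_norm ?divr_gt0 // ger_pMr ?divr_gt0.
Qed.

End Cosecant.

(** * The integral of [p^(-alpha) / (1 + p)] *)

Lemma powRB1E (R : realType) (x b : R) : 0 < x -> x `^ (b - 1) = x `^ b / x.
Proof. by move=> x0; rewrite powRB ?powRr1 ?(gt_eqF x0) ?implybT // ltW. Qed.

Lemma is_derive_powR_div (R : realType) (x b : R) : 0 < x -> b != 0 ->
  is_derive x 1 (fun y => y `^ b / b) (x `^ (b - 1)).
Proof.
move=> x0 b0; have := is_deriveMl_fun b^-1 (is_derive1_powR b x0).
rewrite mulKf //; congr (is_derive _ _ _ _).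
by apply/funext => y; rewrite mulrC.
Qed.

Lemma le_of_harmonic (R : realType) (x y K : R) : 0 <= K ->
  (forall n : nat, x <= y + K / n.+1%:R) -> x <= y.
Proof.
move=> K0 H; apply/ler_addgt0Pr => e e0.
have := archi_boundP (divr_ge0 K0 (ltW e0)); set n := Num.bound _ => /ltW nK.
apply: le_trans (H n) _; rewrite lerD2l ler_pdivrMr // mulrC -ler_pdivrMr //.
by apply: le_trans nK _; rewrite ler_nat.
Qed.

Section BetaIntegral.
Variables (R : realType) (alpha : R).
Hypothesis halpha : 0 < alpha < 1.

Let a0 : 0 < alpha. Proof. by case/andP: halpha. Qed.
Let b0 : 0 < 1 - alpha. Proof. by case/andP: halpha; rewrite subr_gt0. Qed.

Let mu := @lebesgue_measure R.
Let w (y : R) : R := (1 + y `^ (1 - alpha)^-1)^-1.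
Let W (q : R) : R := \int[mu]_(y in `[0, q]) w y.

Let w_continuous (x : R) : 0 < x -> {for x, continuous w}.
Proof.
move=> x0; have p0 : 1 + x `^ (1 - alpha)^-1 != 0.
  by rewrite gt_eqF // ltr_wpDr ?powR_ge0.
exact: (is_derive_continuous
  (is_deriveV_fun (f := fun y => 1 + y `^ (1 - alpha)^-1) p0
  (is_deriveD_fun (is_derive_cst (1 : R) x 1) (is_derive1_powR _ x0)))).
Qed.

Let w_within u : {within `[0, u], continuous w}.
Proof.
have [u0|u0] := leP u 0.
  apply: (@continuous_subspaceW _ _ _ [set 0]); last exact: continuous_subspace1.
  by move=> x /=; rewrite in_itv /= => /andP[x0 xu]; apply/le_anti/andP; split=> //; exact: le_trans xu u0.
apply/continuous_within_itvP => //; split.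
- by move=> x; rewrite in_itv /= => /andP[x0 _]; exact: w_continuous.
- rewrite {2}/w powR0 ?invr_eq0 ?gt_eqF // addr0 invr1.
  have H : 1 + y `^ (1 - alpha)^-1 @[y --> 0^'+] --> (1 + 0 : R).
    by apply: cvgD; [exact: cvg_cst|apply: powR_cvg0; rewrite invr_gt0].
  rewrite addr0 in H; have := cvgV (oner_neq0 R) H.
  by rewrite invr1; apply.
- exact/cvg_at_left_filter/w_continuous.
Qed.

Let w_integrable u : mu.-integrable `[0, u] (EFin \o w).
Proof.
by apply: continuous_compact_integrable; [exact: segment_compact|exact: w_within].
Qed.

Let W0 : W 0 = 0.
Proof. by rewrite /W set_itv1 Rintegral_set1. Qed.

Let W_within (u : R) : 0 <= u -> {within `[0, u], continuous W}.
Proof. by move=> u0; exact: parameterized_integral_continuous. Qed.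

Let is_derive_W (x : R) : 0 < x -> is_derive x 1 W (w x).
Proof.
move=> x0; have [] := @continuous_FTC1_closed R w 0 x (x + 1) _ (w_integrable _) x0
  (w_continuous x0); first by rewrite ltrDl.
move=> dW WE; split; first exact: dW.
by rewrite -derive1E; exact: WE.
Qed.

Let w01 (y : R) : 0 <= w y <= 1.
Proof.
rewrite /w invr_ge0 addr_ge0 ?powR_ge0 //= invf_le1 ?lerDl ?powR_ge0 //.
by rewrite ltr_wpDr ?powR_ge0.
Qed.

Let W_le (q : R) : 0 <= q -> 0 <= W q <= q.
Proof.
move=> q0; apply/andP; split.
  rewrite -[leLHS]W0; apply: (@derive_ge0_le _ W w) => //; first exact: W_within.
    by move=> x /andP[x0 _]; exact: is_derive_W.
  by move=> x _; case/andP: (w01 x).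
rewrite -[leLHS]subr0 -[X in _ - X]W0 -[leRHS]subr0; apply: le_trans (ler_norm _) _.
apply: (@derive_dist_le _ W id w (cst 1)) => //; first exact: W_within.
- by apply: continuous_subspaceT => x; exact: cvg_id.
- by move=> x /andP[x0 _]; exact: is_derive_W.
- by move=> x _; case/andP: (w01 x) => ? ?; rewrite ger0_norm.
Qed.

(* The integral of [p^(-alpha) / (1 + p)] over [[0, t]], desingularised by
   the substitution [p = y^(1 / (1 - alpha))]. *)
Definition beta_int (t : R) : R := W (t `^ (1 - alpha)) / (1 - alpha).

Lemma beta_int0 : beta_int 0 = 0.
Proof. by rewrite /beta_int powR0 ?gt_eqF // W0 mul0r. Qed.

Lemma beta_int_bound t : 0 <= beta_int t <= t `^ (1 - alpha) / (1 - alpha).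
Proof.
have /andP[W1 W2] := W_le (powR_ge0 t (1 - alpha)).
by rewrite divr_ge0 ?(ltW b0) //= ler_pM2r ?invr_gt0.
Qed.

Lemma is_derive_beta_int (t : R) : 0 < t ->
  is_derive t 1 beta_int (t `^ (- alpha) / (1 + t)).
Proof.
move=> t0; have tb0 : 0 < t `^ (1 - alpha) by exact: powR_gt0.
have := is_deriveMl_fun (1 - alpha)^-1
  (is_derive_comp_fun (g := fun y => y `^ (1 - alpha)) (is_derive_W tb0) (is_derive1_powR (1 - alpha) t0)).
have -> : (fun y => (1 - alpha)^-1 * W (y `^ (1 - alpha))) = beta_int.
  by apply/funext => y; rewrite mulrC.
congr (is_derive _ _ _ _); rewrite /w -powRrM divff ?gt_eqF // powRr1 ?(ltW t0) //.
have -> : 1 - alpha - 1 = - alpha by ring.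
rewrite mulrCA (mulrC _ (t `^ _)) mulrCA mulrA.
by field; rewrite !gt_eqF // addr_gt0.
Qed.

Lemma beta_int_cvg0 : beta_int x @[x --> 0^'+] --> beta_int 0.
Proof.
rewrite beta_int0.
have c0 : x `^ (1 - alpha) / (1 - alpha) @[x --> 0^'+] --> 0.
  rewrite -[X in _ --> X](mul0r (1 - alpha)^-1); apply: cvgM; last exact: cvg_cst.
  exact: powR_cvg0.
apply: squeeze_cvgr (cvg_cst 0) c0; near=> x.
exact: beta_int_bound.
Unshelve. all: by end_near. Qed.

Lemma beta_int_within (u : R) : 0 < u -> {within `[0, u], continuous beta_int}.
Proof.
move=> u0; apply: (continuous_itv_derive u0 beta_int_cvg0) => x /andP[x0 _].
exact: is_derive_beta_int.
Qed.

Lemma beta_int_le (s t : R) : 0 <= s -> s <= t -> beta_int s <= beta_int t.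
Proof.
rewrite le_eqVlt => /predU1P[<- _|s0 st].
  by rewrite beta_int0; case/andP: (beta_int_bound t).
apply: (@derive_ge0_le _ beta_int (fun t => t `^ (- alpha) / (1 + t))) => //.
- apply: derivable_within_continuous => x; rewrite in_itv /= => /andP[sx _].
  have /is_derive_beta_int dx : 0 < x by exact: lt_le_trans sx.
  exact: ex_derive.
- by move=> x /andP[sx _]; apply: is_derive_beta_int; exact: lt_trans sx.
- move=> x /andP[sx _]; rewrite divr_ge0 ?powR_ge0 // addr_ge0 // ltW //.
  exact: lt_trans sx.
Qed.

End BetaIntegral.

(** * Alternating expansion of the integral of p^(b - 1) / (1 + p) *)

Section AlternatingSeries.
Variables (R : realType) (b : R).
Hypothesis b0 : 0 < b.

Let bn0 n : 0 < n%:R + b. Proof. by rewrite ltr_wpDl. Qed.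

(* Partial sum of the expansion of the integral of [p^(b - 1) / (1 + p)]
   over [[0, t]]. *)
Definition alt_sum N (t : R) : R :=
  \sum_(n < N) (-1) ^+ n * (t `^ (n%:R + b) / (n%:R + b)).

(** Closed form of a geometric sum of ratio -t, so that its distance to t^(b - 1) / (1 + t) is a
    single term. *)
Definition alt_sum_deriv N (t : R) : R :=
  t `^ (b - 1) * (1 - (- t) ^+ N) / (1 + t).

Lemma powR_addn (t : R) n : 0 < t -> t `^ (n%:R + b - 1) = t `^ (b - 1) * t ^+ n.
Proof.
move=> t0; rewrite -addrA (@powRD _ t n%:R); last by rewrite (gt_eqF t0) implybT.
by rewrite powR_mulrn ?ltW // mulrC.
Qed.

Lemma alt_sum_derivE N (t : R) : 0 < t ->
  t `^ (b - 1) / (1 + t) - alt_sum_deriv N t = t `^ (b - 1) * (- t) ^+ N / (1 + t).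
Proof. by move=> t0; rewrite /alt_sum_deriv; ring. Qed.

Lemma is_derive_alt_sum N (t : R) : 0 < t ->
  is_derive t 1 (alt_sum N) (alt_sum_deriv N t).
Proof.
move=> t0; have t1 : 1 + t != 0 by rewrite gt_eqF // addr_gt0.
have := @is_derive_sum_fun R N
  (fun n y => (-1) ^+ n * (y `^ (n%:R + b) / (n%:R + b)))
  (fun n y => (-1) ^+ n * y `^ (n%:R + b - 1)) t.
have -> : alt_sum_deriv N t = \sum_(i < N) (-1) ^+ i * t `^ (i%:R + b - 1).
  rewrite /alt_sum_deriv -[RHS](mulfK t1); congr (_ / _).
  elim: N => [|N IH]; first by rewrite big_ord0 expr0 subrr mulr0 mul0r.
  rewrite big_ord_recr /= mulrDl -IH powR_addn // exprS.
  by rewrite (_ : (- t) ^+ N = (-1) ^+ N * t ^+ N); [ring|rewrite -exprMn mulN1r].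
apply=> i _; apply: is_deriveMl_fun; apply: is_derive_powR_div => //.
by rewrite gt_eqF.
Qed.

Lemma alt_sum0 N : alt_sum N 0 = 0.
Proof.
by rewrite /alt_sum big1 // => i _; rewrite powR0 ?gt_eqF // mul0r mulr0.
Qed.

Lemma powR_div_cvg0 (c : R) : 0 < c -> x `^ c / c @[x --> 0^'+] --> (0 : R).
Proof.
move=> c0; have := cvgM (powR_cvg0 c0) (cvg_cst c^-1).
by rewrite mul0r; exact.
Qed.

Lemma powR_div_within (c u : R) : 0 < c -> 0 < u ->
  {within `[0, u], continuous (fun x => x `^ c / c)}.
Proof.
move=> c0 u0; apply: (@continuous_itv_derive _ _ (fun x => x `^ (c - 1))) => //.
  by rewrite powR0 ?gt_eqF // mul0r; exact: powR_div_cvg0.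
by move=> x /andP[x0 _]; apply: is_derive_powR_div => //; rewrite gt_eqF.
Qed.

Lemma alt_sum_within N (u : R) : 0 < u -> {within `[0, u], continuous (alt_sum N)}.
Proof.
move=> u0; apply: (@continuous_itv_derive _ _ (alt_sum_deriv N)) => //; last first.
  by move=> x /andP[x0 _]; exact: is_derive_alt_sum.
rewrite alt_sum0 /alt_sum; elim: N => [|N IH].
  under eq_fun do rewrite big_ord0; exact: cvg_cst.
under eq_fun do rewrite big_ord_recr /=.
have := cvgD IH (cvgM (cvg_cst ((-1) ^+ N : R)) (powR_div_cvg0 (bn0 N))).
by rewrite mulr0 addr0; exact.
Qed.

Lemma alt_sum_deriv_dist N (t : R) : 0 < t ->
  `|t `^ (b - 1) / (1 + t) - alt_sum_deriv N t| <= t `^ (N%:R + b - 1).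
Proof.
move=> t0; rewrite alt_sum_derivE // powR_addn // !normrM normrX normrN.
rewrite ger0_norm ?powR_ge0 // (gtr0_norm t0) normfV gtr0_norm ?addr_gt0 //.
rewrite ler_piMr ?mulr_ge0 ?powR_ge0 ?exprn_ge0 ?ltW // invf_lt1 ?addr_gt0 //.
by rewrite ltrDl.
Qed.

(** For t <= 1 the factor 1 - (-t)^N is at most 2 in modulus. The point is uniformity in [N]: the
    bound survives when the number of terms goes to infinity. *)
Lemma alt_sum_le N (t : R) : 0 < t <= 1 -> `|alt_sum N t| <= 2 * (t `^ b / b).
Proof.
move=> /andP[t0 t1].
rewrite -[X in `|X|]subr0 -(alt_sum0 N).
have -> : 2 * (t `^ b / b) = 2 * (t `^ b / b) - 2 * (0 `^ b / b).
  by rewrite powR0 ?gt_eqF // mul0r mulr0 subr0.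
apply: (@derive_dist_le _ (alt_sum N) (fun x => 2 * (x `^ b / b)) (alt_sum_deriv N)
  (fun x => 2 * x `^ (b - 1))); rewrite ?(ltW t0) //.
- exact: alt_sum_within.
- by move=> x; apply: cvgM; [exact: cvg_cst|exact: powR_div_within].
- by move=> x /andP[x0 _]; exact: is_derive_alt_sum.
- move=> x /andP[x0 _]; apply: is_deriveMl_fun; apply: is_derive_powR_div => //.
  by rewrite gt_eqF.
- move=> x /andP[x0 xt]; have x1 : x <= 1 by exact: ltW (lt_le_trans xt t1).
  rewrite /alt_sum_deriv !normrM ger0_norm ?powR_ge0 // -mulrA mulrC.
  have x10 : 0 < 1 + x by rewrite addr_gt0.
  rewrite ler_wpM2r ?powR_ge0 // normfV (gtr0_norm x10) ler_pdivrMr //; apply: le_trans (ler_normB _ _) _.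
  rewrite normr1 normrX normrN gtr0_norm //.
  have : x ^+ N <= 1 by rewrite exprn_ile1 // ltW.
  lra.
Qed.

End AlternatingSeries.

(** * Value of the integral over the half-line *)

Section BetaIntegralLimit.
Variables (R : realType) (alpha : R).
Hypothesis halpha : 0 < alpha < 1.

Let a0 : 0 < alpha. Proof. by case/andP: halpha. Qed.
Let b0 : 0 < 1 - alpha. Proof. by case/andP: halpha; rewrite subr_gt0. Qed.

Let T := beta_int alpha.

Let bexp : 1 - alpha - 1 = - alpha. Proof. by ring. Qed.

(** The remainder of the geometric series is at most t^(N - alpha), whose integral over [0, 1] is
    the stated bound. *)
Let beta_int1_dist N :
  `|T 1 - alt_sum (1 - alpha) N 1| <= (N%:R + (1 - alpha))^-1.
Proof.
have n0 : 0 < N%:R + (1 - alpha) by rewrite ltr_wpDl.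
have -> : T 1 - alt_sum (1 - alpha) N 1 =
    (T 1 - alt_sum (1 - alpha) N 1) - (T 0 - alt_sum (1 - alpha) N 0).
  by rewrite /T beta_int0 // alt_sum0 // !subr0.
have -> : (N%:R + (1 - alpha))^-1 = 1 `^ (N%:R + (1 - alpha)) / (N%:R + (1 - alpha))
    - 0 `^ (N%:R + (1 - alpha)) / (N%:R + (1 - alpha)).
  by rewrite powR1 powR0 ?gt_eqF // mul0r subr0 mul1r.
apply: (@derive_dist_le _ (fun x => T x - alt_sum (1 - alpha) N x)
  (fun x => x `^ (N%:R + (1 - alpha)) / (N%:R + (1 - alpha)))
  (fun x => x `^ (- alpha) / (1 + x) - alt_sum_deriv (1 - alpha) N x)
  (fun x => x `^ (N%:R + (1 - alpha) - 1))) => //.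
- move=> x; apply: continuousD; first exact: beta_int_within.
  by apply: continuousN; exact: alt_sum_within.
- exact: powR_div_within.
- move=> x /andP[x0 _]; apply: is_deriveB_fun; first exact: is_derive_beta_int.
  exact: is_derive_alt_sum.
- by move=> x /andP[x0 _]; apply: is_derive_powR_div; rewrite ?gt_eqF.
- by move=> x /andP[x0 _]; have := alt_sum_deriv_dist (1 - alpha) N x0; rewrite bexp.
Qed.

(** Under p = 1/x the integrand becomes x^(alpha - 1) / (1 + x), which is the integrand on [0, 1]
    with 1 - alpha replaced by alpha. The comparison runs over [e, 1]; the partial sum at the lower
    end [e] contributes 2 e^alpha / alpha. *)
Let beta_int_inv_dist N (e : R) : 0 < e <= 1 ->
  `|T e^-1 - (T 1 + alt_sum alpha N 1)| <=
  2 * (e `^ alpha / alpha) + (N%:R + alpha)^-1.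
Proof.
move=> /andP[e0 e1]; have n0 : 0 < N%:R + alpha by rewrite ltr_wpDl.
have H : `|(T 1^-1 + alt_sum alpha N 1) - (T e^-1 + alt_sum alpha N e)| <=
    1 `^ (N%:R + alpha) / (N%:R + alpha) - e `^ (N%:R + alpha) / (N%:R + alpha).
  have D1 (x : R) : 0 < x -> is_derive x 1 (fun x => T x^-1 + alt_sum alpha N x)
      (alt_sum_deriv alpha N x - x `^ (alpha - 1) / (1 + x)).
    move=> x0; have xi0 : 0 < x^-1 by rewrite invr_gt0.
    have x0' : x != 0 by rewrite gt_eqF.
    have := is_deriveD_fun (is_derive_comp_fun (is_derive_beta_int halpha xi0)
      (is_deriveV_fun (f := id) x0' (is_derive_id x 1))) (is_derive_alt_sum a0 N x0).
    congr (is_derive _ _ _ _); rewrite addrC; congr (_ + _).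
    have -> : x^-1 `^ (- alpha) = x `^ alpha.
      by rewrite -(powR_inv1 (ltW x0)) -powRrM mulN1r opprK.
    rewrite powRB1E //; field.
    by rewrite x0' gt_eqF ?addr_gt0 // gt_eqF // addr_gt0.
  have D2 (x : R) : 0 < x -> is_derive x 1 (fun x => x `^ (N%:R + alpha) / (N%:R + alpha))
      (x `^ (N%:R + alpha - 1)).
    by move=> x0; apply: is_derive_powR_div; rewrite ?gt_eqF.
  apply: (@derive_dist_le _ (fun x => T x^-1 + alt_sum alpha N x)
    (fun x => x `^ (N%:R + alpha) / (N%:R + alpha))
    (fun x => alt_sum_deriv alpha N x - x `^ (alpha - 1) / (1 + x))
    (fun x => x `^ (N%:R + alpha - 1))) => //.
  - apply: derivable_within_continuous => x; rewrite in_itv /= => /andP[ex _].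
    by have /D1 dx : 0 < x; [exact: lt_le_trans ex|exact: ex_derive].
  - apply: derivable_within_continuous => x; rewrite in_itv /= => /andP[ex _].
    by have /D2 dx : 0 < x; [exact: lt_le_trans ex|exact: ex_derive].
  - by move=> x /andP[ex _]; apply: D1; exact: lt_trans ex.
  - by move=> x /andP[ex _]; apply: D2; exact: lt_trans ex.
  - move=> x /andP[ex _]; rewrite distrC; apply: alt_sum_deriv_dist => //.
    exact: lt_trans ex.
have := @alt_sum_le _ _ a0 N e; rewrite e0 e1 => /(_ isT).
have : 0 <= e `^ (N%:R + alpha) / (N%:R + alpha) by rewrite divr_ge0 ?powR_ge0 ?ltW.
move: H; rewrite invr1 powR1 mul1r !ler_norml; clear.
move: (T _) (T _) (alt_sum _ _ _) (alt_sum _ _ _) (e `^ _ / _) (e `^ _ / _).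
move=> x1 x2 x3 x4 x5 x6; move: (_^-1) => x7 /andP[h1 h2] h0 /andP[h3 h4].
by apply/andP; split; lra.
Qed.

(** The indices 0, ..., N give the first sum and -1, ..., -N the second, through i + (1 - alpha) = -
    (alpha - (i + 1)); the term n = 0 makes the first sum one longer. *)
Let csc_sumE N : csc_sum alpha N = alt_sum alpha N.+1 1 + alt_sum (1 - alpha) N 1.
Proof.
rewrite /csc_sum /alt_sum big_ord_recl /= expr0 powR1 !mul1r add0r -addrA.
congr (_ + _); rewrite -big_split /=; apply: eq_bigr => i _.
rewrite !mul1r mulrDr exprS; congr (_ + _).
  by rewrite /bump leq0n add1n addrC.
have -> : i%:R + (1 - alpha) = - (alpha - i.+1%:R) by rewrite -natr1; ring.
by rewrite invrN; ring.
Qed.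

Lemma sin_alpha_pi_gt0 : 0 < sin (alpha * pi).
Proof.
apply: sin_gt0_pi; rewrite mulr_gt0 ?pi_gt0 //=.
by rewrite gtr_pMl ?pi_gt0 //; case/andP: halpha.
Qed.

Lemma beta_int_limit (e : R) : 0 < e <= 1 ->
  `|T e^-1 - pi / sin (alpha * pi)| <= 2 * (e `^ alpha / alpha).
Proof.
move=> e01; have s0 := sin_alpha_pi_gt0; have p0 := pi_gt0 R.
set s := sin _ in s0 *.
(* Each half of the integral contributes 1 to this constant and the cosecant sum, divided by [s],
   the rest. Below, [n.+2] terms on one side and [n.+1] on the other match [csc_sumE]. *)
have K0 : 0 <= 2 + (2 + 4 * pi) / s by rewrite addr_ge0 // divr_ge0 // ?ltW //; lra.
apply: (le_of_harmonic K0) => n.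
have h1 := beta_int_inv_dist n.+2 e01.
have h2 := beta_int1_dist n.+1.
have h3 := @csc_sum_dist _ _ halpha n.+1; rewrite -/s in h3.
have n0 : 0 < n.+1%:R :> R by [].
have e1 : (n.+2%:R + alpha)^-1 <= n.+1%:R^-1.
  rewrite lef_pV2 ?posrE //; last by rewrite ltr_wpDl.
  by rewrite ler_wpDr ?(ltW a0) // ler_nat.
have e2 : (n.+1%:R + (1 - alpha))^-1 <= n.+1%:R^-1.
  have n1 : 0 < n.+1%:R + (1 - alpha) by rewrite ltr_wpDl.
  by rewrite lef_pV2 ?posrE // ler_wpDr ?(ltW b0).
have e3 : (2 + 4 * pi : R) / (n.+1%:R + 2^-1) <= (2 + 4 * pi) / n.+1%:R.
  have n1 : 0 < n.+1%:R + 2^-1 :> R by rewrite ltr_wpDl.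
  by apply: ler_wpM2l; [lra|rewrite lef_pV2 ?posrE ?lerDl].
have h4 : `|pi / s - csc_sum alpha n.+1| <= (2 + 4 * pi) / s / n.+1%:R.
  rewrite (_ : pi / s - _ = (pi - s * csc_sum alpha n.+1) / s); last first.
    by field; rewrite gt_eqF.
  rewrite normrM normfV (gtr0_norm s0) ler_pdivrMr //.
  apply: le_trans h3 _; apply: le_trans e3 _.
  by rewrite mulrAC divfK // gt_eqF.
rewrite csc_sumE in h4.
move: h1 h2 h4 e1 e2; rewrite (mulrDl 2 ((2 + 4 * pi) / s)) !ler_norml; clear.
move: (T _) (T _) (alt_sum _ _ _) (alt_sum _ _ _) (e `^ _ / _) (pi / s).
move: ((2 + 4 * pi) / s * _) => y1; move: (n.+1%:R^-1) => y2; move: (_^-1) (_^-1).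
move=> z1 z2 z3 z4 z5 z6 z7 z8.
move=> /andP[x1 x2] /andP[x3 x4] /andP[x5 x6] e1 e2.
by apply/andP; split; lra.
Qed.

Lemma beta_int_le_limit (t : R) : 0 <= t -> T t <= pi / sin (alpha * pi).
Proof.
move=> t0; apply/ler_addgt0Pr => e e0.
(* The three entries give, in turn, d <= 1, t <= 1/d, and an error 2 d^alpha / alpha of at most
   [e]. *)
pose d := Num.min (Num.min 1 (t + 1)^-1) ((e * alpha / 2) `^ alpha^-1).
have t1 : 0 < t + 1 by rewrite ltr_wpDl.
have ea : 0 < e * alpha / 2 by rewrite divr_gt0 // mulr_gt0.
have d0 : 0 < d by rewrite /d !lt_min ltr01 invr_gt0 t1 powR_gt0.
have d1 : d <= 1 by rewrite /d !ge_min lexx.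
have td : t <= d^-1.
  rewrite -[leLHS]invrK; have [->|tn0] := eqVneq t 0; first by rewrite !invr0 invr_ge0 ltW.
  rewrite invrK; apply: (@le_trans _ _ (t + 1)); first by rewrite lerDl.
  rewrite -[leLHS]invrK lef_pV2 ?posrE ?invr_gt0 //.
  by rewrite /d !ge_min lexx orbT.
have dd : 2 * (d `^ alpha / alpha) <= e.
  rewrite mulrA ler_pdivrMr // -ler_pdivlMl // mulrC.
  have -> : e * alpha / 2 = ((e * alpha / 2) `^ alpha^-1) `^ alpha.
    by rewrite -powRrM mulVf ?gt_eqF // powRr1 // ltW.
  by apply: ge0_ler_powR; rewrite ?nnegrE ?powR_ge0 ?(ltW a0) ?(ltW d0) // /d ge_min lexx orbT.
apply: le_trans (beta_int_le halpha t0 td) _.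
have := @beta_int_limit d; rewrite d0 d1 ler_norml => /(_ isT) /andP[_] H.
rewrite -lerBlDl; exact: le_trans H dd.
Qed.

End BetaIntegralLimit.

(** * The Hilbert kernel on the unit interval *)

Lemma powR_small (R : realType) (a e : R) : 0 < a -> 0 < e ->
  exists2 d, 0 < d & forall x, 0 < x <= d -> x `^ a <= e.
Proof.
move=> a0 e0; exists (e `^ a^-1); first exact: powR_gt0.
move=> x /andP[x0 xd].
have -> : e = (e `^ a^-1) `^ a by rewrite -powRrM mulVf ?gt_eqF // powRr1 // ltW.
by apply: ge0_ler_powR; rewrite ?nnegrE ?powR_ge0 // ltW.
Qed.

Lemma le_of_onem_scaled (R : realType) (x y h0 : R) : 0 <= x -> 0 < h0 ->
  (forall h, 0 < h <= h0 -> (1 - h) * x <= y) -> x <= y.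
Proof.
move=> x0 h00 H; apply/ler_addgt0Pr => e e0.
pose h := Num.min h0 (e / (x + 1)).
have x1 : 0 < x + 1 by rewrite ltr_wpDl.
have h_gt0 : 0 < h by rewrite lt_min h00 divr_gt0.
have := H h; rewrite h_gt0 /= ge_min lexx => /(_ isT).
have : h * (x + 1) <= e by rewrite -ler_pdivlMr // /h ge_min lexx orbT.
nra.
Qed.

Lemma integral_itvco_le (R : realType) (f : R -> R) (M : \bar R) :
  (forall x, 0 <= x < 1 -> 0 <= f x) -> measurable_fun (`[0, 1[ : set R) f ->
  (forall b, 0 < b < 1 -> (\int[lebesgue_measure]_(x in `[0%R, b]) (f x)%:E <= M)%E) ->
  (\int[lebesgue_measure]_(x in `[0%R, 1%R[) (f x)%:E <= M)%E.
Proof.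
move=> f0 mf H; pose F (n : nat) : set R := `[0, 1 - n.+1%:R^-1]%classic.
have F1 n : (F n `<=` `[0, 1[)%classic.
  move=> x; rewrite /F /= !in_itv /= => /andP[-> xn] /=.
  by apply: le_lt_trans xn _; rewrite ltrBlDr ltrDl invr_gt0.
have H0 n : (\int[lebesgue_measure]_(x in F n) (f x)%:E <= M)%E.
  (* [F 0] is the single point 0, whereas the hypothesis asks for 0 < b; hence the shift to
     [n.+1]. *)
  apply: (@le_trans _ _ (\int[lebesgue_measure]_(x in F n.+1) (f x)%:E)%E).
    apply: ge0_subset_integral => //=.
    - exact: measurable_itv.
    - exact: measurable_itv.
    - by apply/measurable_EFinP; apply: measurable_funS mf => //; exact: F1.
    - by move=> x /F1; rewrite /= in_itv lee_fin; exact: f0.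
    - move=> x; rewrite /F /= !in_itv /= => /andP[-> xn] /=.
      by apply: le_trans xn _; rewrite lerB // lef_pV2 ?posrE // ler_nat.
  apply: H; rewrite subr_gt0 invf_lt1 ?ltr1n //= ltrBlDr ltrDl invr_gt0 //.
have mF n : measurable (F n) by exact: measurable_itv.
have mfF n : measurable_fun (F n) (EFin \o f).
  by apply/measurable_EFinP; apply: measurable_funS mf => //; exact: F1.
have f0F n x : F n x -> (0 <= (f x)%:E)%E.
  by move=> /F1; rewrite /= in_itv lee_fin; exact: f0.
have ndF : nondecreasing_seq F.
  apply/nondecreasing_seqP => n; apply/subsetPset => x.
  rewrite /F /= !in_itv /= => /andP[-> xn] /=.
  by apply: le_trans xn _; rewrite lerB // lef_pV2 ?posrE // ler_nat.
rewrite itv_bnd_open_bigcup.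
have <- : limn (fun n => \int[lebesgue_measure]_(x in F n) (f x)%:E)%E =
    (\int[lebesgue_measure]_(x in \bigcup_k F k) (f x)%:E)%E.
  by apply/cvg_lim => //; exact: ge0_nondecreasing_set_cvg_integral.
apply: lime_le; last by apply: nearW.
apply: ereal_nondecreasing_is_cvgn.
exact: ge0_nondecreasing_set_nondecreasing_integral.
Qed.

Lemma denom_gt0 (R : realType) (r x : R) : 0 <= r < 1 -> 0 <= x <= 1 -> 0 < 1 - r * x.
Proof.
move=> /andP[r0 r1] /andP[x0 x1]; rewrite subr_gt0.
by apply: le_lt_trans r1; rewrite ler_piMr.
Qed.

Section HilbertKernel.
Variables (R : realType) (alpha : R).
Hypothesis halpha : 0 < alpha < 1.

Let a0 : 0 < alpha. Proof. by case/andP: halpha. Qed.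
Let b0 : 0 < 1 - alpha. Proof. by case/andP: halpha; rewrite subr_gt0. Qed.

Let mu := @lebesgue_measure R.

Definition hilbert_const : R := pi / sin (alpha * pi).

Lemma hilbert_const_gt0 : 0 < hilbert_const.
Proof. by rewrite divr_gt0 ?pi_gt0 //; exact: sin_alpha_pi_gt0. Qed.

Definition hilbert_kernel (r x : R) : R := (1 - x) `^ (- alpha) / (1 - r * x).

Lemma hilbert_kernel_ge0 (r x : R) : 0 <= r < 1 -> 0 <= x <= 1 ->
  0 <= hilbert_kernel r x.
Proof. by move=> r01 x01; rewrite divr_ge0 ?powR_ge0 // ltW ?denom_gt0. Qed.

Lemma is_derive_onem_powR (c x : R) : x < 1 ->
  is_derive x 1 (fun y => (1 - y) `^ c) (- (c * (1 - x) `^ (c - 1))).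
Proof.
move=> x1; have x0 : 0 < 1 - x by rewrite subr_gt0.
have := is_derive_comp_fun (f := fun y => y `^ c) (g := fun y => 1 - y) (is_derive1_powR c x0) (is_derive_onem x).
by rewrite mulrN1.
Qed.

Lemma hilbert_kernel_continuous (r x : R) : 0 <= r < 1 -> 0 <= x < 1 ->
  {for x, continuous (hilbert_kernel r)}.
Proof.
move=> r01 /andP[x0 x1].
have d0 : 1 - r * x != 0 by rewrite gt_eqF // denom_gt0 // x0 ltW.
exact: (is_derive_continuous (is_deriveM_fun (is_derive_onem_powR (- alpha) x1)
  (is_deriveV_fun (f := fun y => 1 - r * y) d0 (is_derive_denom r x)))).
Qed.

Lemma hilbert_kernel_within (r b : R) : 0 <= r < 1 -> b < 1 ->
  {within `[0, b], continuous (hilbert_kernel r)}.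
Proof.
move=> r01 b1; apply: continuous_in_subspaceT => x.
rewrite inE /= in_itv /= => /andP[x0 xb]; apply: hilbert_kernel_continuous => //.
by rewrite x0 (le_lt_trans xb).
Qed.

Lemma hilbert_kernel_measurable (r : R) : 0 <= r < 1 ->
  measurable_fun (`[0, 1[ : set R) (hilbert_kernel r).
Proof.
move=> r01; apply/measurable_fun_itv_obnd_cbndP.
apply: open_continuous_measurable_fun => // x; rewrite inE /= in_itv /= => /andP[x0 x1].
by apply: hilbert_kernel_continuous => //; rewrite ltW.
Qed.

Lemma hilbert_kernel_integral (r b : R) : 0 < r < 1 -> 0 < b < 1 ->
  (\int[mu]_(x in `[0%R, b]) (hilbert_kernel r x)%:E =
  ((1 - r) `^ (- alpha) * r `^ (alpha - 1) *
   (beta_int alpha (r / (1 - r)) - beta_int alpha (r * (1 - b) / (1 - r))))%:E)%E.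
Proof.
move=> /andP[r0 r1] /andP[bb0 b1]; have d0 : 0 < 1 - r by rewrite subr_gt0.
have d0' : 1 - r != 0 by rewrite gt_eqF.
pose k := (1 - r) `^ (- alpha) * r `^ (alpha - 1).
(* The substitution p = r (1 - x) / (1 - r), read as an antiderivative. It is used up to b < 1 only,
   the kernel being unbounded at 1. *)
pose F x := - k * beta_int alpha (r / (1 - r) * (1 - x)).
have dF (x : R) : 0 <= x < 1 -> is_derive x 1 F (hilbert_kernel r x).
  move=> /andP[x0 x1]; have u0 : 0 < 1 - x by rewrite subr_gt0.
  have t0 : 0 < r / (1 - r) * (1 - x) by rewrite mulr_gt0 ?divr_gt0.
  have den0 : 0 < 1 - r * x by rewrite denom_gt0 ?(ltW r0) ?x0 ?(ltW x1).
  have := is_deriveMl_fun (- k) (is_derive_comp_fun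
    (g := fun y => r / (1 - r) * (1 - y)) (is_derive_beta_int halpha t0)
    (is_deriveMl_fun (r / (1 - r)) (is_derive_onem x))).
  congr (is_derive _ _ _ _); rewrite /k /hilbert_kernel powRM ?divr_ge0 ?(ltW r0) ?(ltW d0) ?(ltW u0) //.
  rewrite powRM ?invr_ge0 ?(ltW r0) ?(ltW d0) //.
  have -> : (1 - r)^-1 `^ (- alpha) = (1 - r) `^ alpha.
    by rewrite -(powR_inv1 (ltW d0)) -powRrM mulN1r opprK.
  rewrite powRB1E // !powRN; field.
  by rewrite !gt_eqF ?powR_gt0 //.
rewrite (@continuous_FTC2 _ _ F) //.
- rewrite -EFinB /F subr0 mulr1 [r / (1 - r) * _]mulrAC; congr (_%:E).
  by rewrite -/k; clear; move: k (beta_int _ _) (beta_int _ _) => k' A B; ring.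
- by apply: hilbert_kernel_within => //; rewrite (ltW r0).
- split.
  + move=> x; rewrite in_itv /= => /andP[x0 xb].
    by have /dF ? : 0 <= x < 1 by rewrite (ltW x0) (lt_trans xb).
  + by apply/cvg_at_right_filter/(is_derive_continuous (dF 0 _)); rewrite lexx ltr01.
  + by apply/cvg_at_left_filter/(is_derive_continuous (dF b _)); rewrite (ltW bb0).
- move=> x; rewrite in_itv /= => /andP[x0 xb].
  rewrite derive1E; have /dF ? : 0 <= x < 1 by rewrite (ltW x0) (lt_trans xb).
  exact: derive_val.
Qed.

End HilbertKernel.

(** * Upper bound for the kernel integral *)

Section KernelUpper.
Variables (R : realType) (alpha : R).
Hypothesis halpha : 0 < alpha < 1.

Let a0 : 0 < alpha. Proof. by case/andP: halpha. Qed.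
Let b0 : 0 < 1 - alpha. Proof. by case/andP: halpha; rewrite subr_gt0. Qed.

Let mu := @lebesgue_measure R.

(** This is [K r] of the overview after the substitution. *)
Let psi (r : R) : R := r `^ (alpha - 1) * beta_int alpha (r / (1 - r)).

Let dpsi (r : R) : R :=
  (alpha - 1) * r `^ (alpha - 1 - 1) * beta_int alpha (r / (1 - r))
  + r^-1 * (1 - r) `^ (alpha - 1).

Let is_derive_psi (r : R) : 0 < r < 1 -> is_derive r 1 psi (dpsi r).
Proof.
move=> /andP[r0 r1]; have d0 : 0 < 1 - r by rewrite subr_gt0.
have d0' : 1 - r != 0 by rewrite gt_eqF.
have t0 : 0 < r / (1 - r) by rewrite divr_gt0.
have := is_deriveM_fun (is_derive1_powR (alpha - 1) r0)
  (is_derive_comp_fun (g := fun y => y / (1 - y)) (is_derive_beta_int halpha t0)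
  (is_deriveM_fun (is_derive_id r 1) (is_deriveV_fun (f := fun y => 1 - y) d0' (is_derive_onem r)))).
congr (is_derive _ _ _ _); rewrite /dpsi; congr (_ + _).
rewrite powRM ?invr_ge0 ?(ltW r0) ?(ltW d0) //.
have -> : (1 - r)^-1 `^ (- alpha) = (1 - r) `^ alpha.
  by rewrite -(powR_inv1 (ltW d0)) -powRrM mulN1r opprK.
rewrite !powRB1E // powRN; field.
by rewrite subrK oner_eq0 !gt_eqF ?powR_gt0.
Qed.

(** Replacing 1 + p by 1 in the integral gives T t <= t^(1 - alpha) / (1 - alpha); at t = r / (1 -
    r) this bound makes the two terms of [dpsi] cancel exactly. *)
Let dpsi_ge0 (r : R) : 0 < r < 1 -> 0 <= dpsi r.
Proof.
move=> /andP[r0 r1]; have d0 : 0 < 1 - r by rewrite subr_gt0.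
have /andP[_] := beta_int_bound halpha (r / (1 - r)).
rewrite powRM ?invr_ge0 ?(ltW r0) ?(ltW d0) // => H.
have p0 : 0 <= (1 - alpha) * r `^ (alpha - 1 - 1).
  by rewrite mulr_ge0 ?powR_ge0 // ltW.
rewrite /dpsi -subr_le0 opprD; have := ler_wpM2l p0 H.
suff -> : (1 - alpha) * r `^ (alpha - 1 - 1) *
    (r `^ (1 - alpha) * (1 - r)^-1 `^ (1 - alpha) / (1 - alpha)) =
    r^-1 * (1 - r) `^ (alpha - 1) by lra.
have -> : (1 - r)^-1 `^ (1 - alpha) = (1 - r) `^ (alpha - 1).
  by rewrite -(powR_inv1 (ltW d0)) -powRrM mulN1r opprB.
have -> : r `^ (1 - alpha) = r / r `^ alpha by rewrite powRB ?powRr1 ?(gt_eqF r0) ?implybT // ltW.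
rewrite (powRB1E (alpha - 1)) // (powRB1E alpha r0); field.
by rewrite !gt_eqF ?powR_gt0.
Qed.

(* [psi r] increases to [hilbert_const alpha] as [r] tends to 1. *)
Let psi_le (r : R) : 0 < r < 1 -> psi r <= hilbert_const alpha.
Proof.
move=> /andP[r0 r1]; have d0 : 0 < 1 - r by rewrite subr_gt0.
have pos (s : R) : 0 < s -> s < 1 -> 0 <= psi s.
  move=> s0 s1; rewrite mulr_ge0 ?powR_ge0 //.
  by case/andP: (beta_int_bound halpha (s / (1 - s))).
apply: (le_of_onem_scaled _ d0); first exact: pos.
move=> h /andP[h0 hr]; have s0 : 0 < 1 - h by lra.
have rs : r <= 1 - h by lra.
have s1 : 1 - h < 1 by lra.
have : psi r <= psi (1 - h).
  apply: (@derive_ge0_le _ psi dpsi) => //.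
  - apply: derivable_within_continuous => x; rewrite in_itv /= => /andP[rx xs].
    have /is_derive_psi dx : 0 < x < 1.
      by rewrite (lt_le_trans r0 rx) (le_lt_trans xs).
    exact: ex_derive.
  - by move=> x /andP[rx xs]; apply: is_derive_psi; rewrite (lt_trans r0 rx) (lt_trans xs).
  - by move=> x /andP[rx xs]; apply: dpsi_ge0; rewrite (lt_trans r0 rx) (lt_trans xs).
move=> /(ler_wpM2l (ltW s0)) /le_trans; apply.
have T0 : 0 <= beta_int alpha ((1 - h) / (1 - (1 - h))).
  by case/andP: (beta_int_bound halpha ((1 - h) / (1 - (1 - h)))).
have TC : beta_int alpha ((1 - h) / (1 - (1 - h))) <= hilbert_const alpha.
  by apply: beta_int_le_limit => //; rewrite divr_ge0 // ltW //; lra.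
(* With s = 1 - h, the factor s * s^(alpha - 1) = s^alpha is at most 1: the slack 1 - h absorbs the
   power of s in [psi]. *)
apply: le_trans TC; rewrite /psi mulrA ler_piMl //.
rewrite powRB1E // mulrCA divff ?gt_eqF // mulr1.
rewrite -[leRHS](powRr0 (1 - h)); apply: ger_powR; rewrite ?s0 ?ltW //.
Qed.

Lemma hilbert_kernel_integral_le (r : R) : 0 <= r < 1 ->
  (\int[mu]_(x in `[0%R, 1%R[) (hilbert_kernel alpha r x)%:E <=
   (hilbert_const alpha * (1 - r) `^ (- alpha))%:E)%E.
Proof.
have main (s : R) : 0 < s < 1 ->
  (\int[mu]_(x in `[0%R, 1%R[) (hilbert_kernel alpha s x)%:E <=
   (hilbert_const alpha * (1 - s) `^ (- alpha))%:E)%E.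
  move=> s01; case/andP: (s01) => s0 s1; have s01' : 0 <= s < 1 by rewrite (ltW s0).
  apply: integral_itvco_le.
  - by move=> x /andP[x0 x1]; apply: hilbert_kernel_ge0 => //; rewrite x0 ltW.
  - exact: hilbert_kernel_measurable.
  - move=> b b01; rewrite hilbert_kernel_integral // lee_fin.
    rewrite mulrC mulrCA mulrC ler_wpM2r ?powR_ge0 // mulrC.
    apply: le_trans (psi_le s01); rewrite ler_wpM2l ?powR_ge0 // gerBl.
    by case/andP: (beta_int_bound halpha (s * (1 - b) / (1 - s))).
(* The substitution degenerates at r = 0. There the kernel is below the kernel at any small h > 0,
   and h is sent to 0. *)
move=> /andP[]; rewrite le_eqVlt => /predU1P[<- _|r0 r1]; last by apply: main; rewrite r0.
rewrite subr0 powR1 mulr1.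
set I := (\int[mu]_(x in _) _)%E.
have I0 : (0 <= I)%E.
  apply: integral_ge0 => x; rewrite /= in_itv /= lee_fin => /andP[x0 x1].
  by apply: hilbert_kernel_ge0; rewrite ?lexx ?ltr01 ?x0 ?(ltW x1).
have Ile (h : R) : 0 < h <= 2^-1 ->
    (I <= (hilbert_const alpha * (1 - h) `^ (- alpha))%:E)%E.
  move=> /andP[h0 h1]; have h01 : 0 < h < 1 by rewrite h0 /=; lra.
  apply: le_trans (main _ h01); apply: ge0_le_integral => //.
  - move=> x; rewrite /= in_itv /= lee_fin => /andP[x0 x1].
    by apply: hilbert_kernel_ge0; rewrite ?lexx ?ltr01 ?x0 ?(ltW x1).
  - by apply/measurable_EFinP; apply: hilbert_kernel_measurable; rewrite lexx ltr01.
  - by apply/measurable_EFinP; apply: hilbert_kernel_measurable; lra.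
  - move=> x; rewrite /= in_itv /= lee_fin => /andP[x0 x1].
    rewrite ler_wpM2l ?powR_ge0 // mul0r subr0 invr1 invf_ge1 ?gerBl; last by nra.
    by rewrite mulr_ge0 // ltW.
have Ifin : I \is a fin_num.
  rewrite ge0_fin_numE //; apply: le_lt_trans (Ile 2^-1 _) (ltry _); lra.
rewrite -(fineK Ifin) lee_fin; apply: (@le_of_onem_scaled _ _ _ 2^-1); rewrite ?fine_ge0 //.
move=> h h01; have := Ile h h01; rewrite -{1}(fineK Ifin) lee_fin => Ih.
have s0 : 0 < 1 - h by move: h01; lra.
apply: le_trans (ler_wpM2l (ltW s0) Ih) _.
rewrite mulrCA ler_piMr ?(ltW (hilbert_const_gt0 halpha)) // powRN ler_pdivrMr ?powR_gt0 // mul1r.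
by apply: ger1_powR; [|case/andP: halpha => _ /ltW]; rewrite ?s0 //=; lra.
Qed.

End KernelUpper.

(** * Partial sums of [(1 - x)^(-alpha)] *)

Lemma powR_le1 (R : realType) (x a : R) : 0 <= x -> x <= 1 -> 0 <= a -> x `^ a <= 1.
Proof.
move=> x0 x1 pa; rewrite -[leRHS](_ : 1 `^ a = 1); last by rewrite powR1.
by apply: ge0_ler_powR; rewrite ?nnegrE.
Qed.

Section BinomialSeries.
Variables (R : realType) (alpha : R).
Hypothesis halpha : 0 < alpha < 1.

Let a0 : 0 < alpha. Proof. by case/andP: halpha. Qed.
Let b0 : 0 < 1 - alpha. Proof. by case/andP: halpha; rewrite subr_gt0. Qed.

(* Coefficients of the power series of [(1 - x)^(-alpha)]. *)
Definition binom_coef (n : nat) : R := \prod_(j < n) ((alpha + j%:R) / j.+1%:R).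

Definition binom_sum (n : nat) (x : R) : R := \sum_(k < n) binom_coef k * x ^+ k.

Lemma binom_coef_gt0 n : 0 < binom_coef n.
Proof. by apply: prodr_gt0 => j _; rewrite divr_gt0 // ltr_wpDr. Qed.

Lemma binom_coef_le1 n : binom_coef n <= 1.
Proof.
apply: prodr_ile1 => j _; apply/andP; split.
  by rewrite divr_ge0 // addr_ge0 // ltW.
rewrite ler_pdivrMr // mul1r -natr1 addrC lerD2l.
by case/andP: halpha => _ /ltW.
Qed.

Let binom_coefS n : n.+1%:R * binom_coef n.+1 = (alpha + n%:R) * binom_coef n.
Proof.
rewrite /binom_coef big_ord_recr /= mulrC -mulrA divfK ?pnatr_eq0 //.
exact: mulrC.
Qed.

Lemma binom_sum_ge0 n (x : R) : 0 <= x -> 0 <= binom_sum n x.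
Proof.
move=> x0; apply: sumr_ge0 => k _.
by rewrite mulr_ge0 ?exprn_ge0 // ltW ?binom_coef_gt0.
Qed.

Let dbinom_sum n (x : R) : R := \sum_(k < n) binom_coef k * (k%:R * x ^+ k.-1).

Let is_derive_expr n (x : R) : is_derive x 1 (fun y => y ^+ n) (n%:R * x ^+ n.-1).
Proof.
have := @is_deriveX _ _ id n x 1 1 (is_derive_id x 1).
congr (is_derive _ _ _ _); last by rewrite -[LHS]/(_ * _) mulr1.
by apply/funext => y; elim: n => [|m IH]; rewrite ?expr0 // !exprS -IH.
Qed.

Lemma is_derive_binom_sum n (x : R) :
  is_derive x 1 (binom_sum n) (dbinom_sum n x).
Proof.
apply: (is_derive_sum_fun (h := fun k y => binom_coef k * y ^+ k)
  (dh := fun k y => binom_coef k * (k%:R * y ^+ k.-1))) => k _.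
exact: is_deriveMl_fun.
Qed.

(** The full series solves (1 - x) y' = alpha y; truncation leaves one boundary term. *)
Let dbinom_sumE n (x : R) :
  (1 - x) * dbinom_sum n x - alpha * binom_sum n x =
  - (binom_coef n * (n%:R * x ^+ n.-1)).
Proof.
elim: n => [|n IH].
  by rewrite /dbinom_sum /binom_sum !big_ord0 mul0r !mulr0 subr0 oppr0.
have -> : dbinom_sum n.+1 x = dbinom_sum n x + binom_coef n * (n%:R * x ^+ n.-1).
  by rewrite /dbinom_sum big_ord_recr.
have -> : binom_sum n.+1 x = binom_sum n x + binom_coef n * x ^+ n.
  by rewrite /binom_sum big_ord_recr.
rewrite [binom_coef n.+1 * _]mulrCA [n.+1%:R * _]mulrA binom_coefS /=.
have xn : n%:R * (x * x ^+ n.-1) = n%:R * x ^+ n.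
  by case: n {IH} => [|n]; rewrite ?mul0r // -exprS.
transitivity (((1 - x) * dbinom_sum n x - alpha * binom_sum n x)
   + binom_coef n * (n%:R * x ^+ n.-1)
   - binom_coef n * (n%:R * (x * x ^+ n.-1)) - alpha * (binom_coef n * x ^+ n)).
  by ring.
by rewrite IH xn; ring.
Qed.

(* [F n] decreases from 1, and tends to 1 when [n] grows: it measures how far
   [binom_sum n] is from [(1 - x)^(-alpha)]. *)
Let F n (x : R) : R := (1 - x) `^ alpha * binom_sum n x.
Let dF n (x : R) : R :=
  - ((1 - x) `^ (alpha - 1) * (binom_coef n * (n%:R * x ^+ n.-1))).

Let is_derive_F n (x : R) : x < 1 -> is_derive x 1 (F n) (dF n x).
Proof.
move=> x1; have d0 : 0 < 1 - x by rewrite subr_gt0.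
have := is_deriveM_fun (is_derive_onem_powR alpha x1) (is_derive_binom_sum n x).
congr (is_derive _ _ _ _); rewrite /dF -[RHS]mulrN -dbinom_sumE powRB1E //; field.
by rewrite gt_eqF.
Qed.

Let F_within n (b : R) : b < 1 -> {within `[0, b], continuous (F n)}.
Proof.
move=> b1; apply: derivable_within_continuous => x; rewrite in_itv /= => /andP[_ xb].
have /(is_derive_F n) dx : x < 1 by exact: le_lt_trans b1.
exact: ex_derive.
Qed.

Let F0 n : F n.+1 0 = 1.
Proof.
rewrite /F subr0 powR1 mul1r /binom_sum big_ord_recl /= expr0 mulr1 big1 ?addr0.
  by rewrite /binom_coef big_ord0.
by move=> i _; rewrite exprS mul0r mulr0.
Qed.

Let F_le n (x y : R) : 0 <= x <= y -> y < 1 -> F n y <= F n x.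
Proof.
move=> /andP[x0 xy] y1; rewrite -lerN2.
apply: (@derive_ge0_le _ (fun x => - F n x) (fun x => - dF n x)) => //.
- apply: derivable_within_continuous => z; rewrite in_itv /= => /andP[_ zy].
  have /(is_derive_F n) dz : z < 1 by exact: le_lt_trans y1.
  by apply: derivableN; exact: ex_derive.
- by move=> z /andP[_ zy]; apply: is_deriveN_fun; apply: is_derive_F; exact: lt_trans y1.
- move=> z /andP[xz _]; rewrite /dF opprK !mulr_ge0 ?powR_ge0 ?exprn_ge0 //.
    by rewrite ltW ?binom_coef_gt0.
  by rewrite ltW // (le_lt_trans x0).
Qed.

Lemma binom_sum_le n (x : R) : 0 <= x < 1 -> binom_sum n x <= (1 - x) `^ (- alpha).
Proof.
move=> /andP[x0 x1]; have d0 : 0 < 1 - x by rewrite subr_gt0.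
case: n => [|n]; first by rewrite /binom_sum big_ord0 powR_ge0.
rewrite powRN -[leRHS]mul1r ler_pdivlMr ?powR_gt0 // mulrC -[leRHS](F0 n).
by apply: F_le; rewrite ?lexx.
Qed.

(** [F n] decreases, so its value at [b] controls the whole of [0, b]. *)
Lemma binom_sum_ge n (x b : R) : 0 <= x <= b -> b < 1 ->
  F n b * (1 - x) `^ (- alpha) <= binom_sum n x.
Proof.
move=> /andP[x0 xb] b1; have d0 : 0 < 1 - x by rewrite subr_gt0 (le_lt_trans xb).
rewrite powRN ler_pdivrMr ?powR_gt0 // [leRHS]mulrC.
by apply: F_le; rewrite ?x0.
Qed.

(** In the derivative of [F], (1 - x)^(alpha - 1) is at most its value at [b] and the coefficient is
    at most 1; what remains is the derivative of x^(n + 1). *)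
Let F_dist n (b : R) : 0 < b < 1 ->
  1 - F n.+1 b <= (1 - b) `^ (alpha - 1) * b ^+ n.+1.
Proof.
move=> /andP[bb0 b1]; have d0 : 0 < 1 - b by rewrite subr_gt0.
rewrite -[X in X - _](F0 n); apply: le_trans (ler_norm _) _; rewrite distrC.
have -> : (1 - b) `^ (alpha - 1) * b ^+ n.+1 =
    (1 - b) `^ (alpha - 1) * b ^+ n.+1 - (1 - b) `^ (alpha - 1) * 0 ^+ n.+1.
  by rewrite expr0n mulr0 subr0.
have dg (x : R) : is_derive x 1 (fun x => (1 - b) `^ (alpha - 1) * x ^+ n.+1)
    ((1 - b) `^ (alpha - 1) * (n.+1%:R * x ^+ n)).
  by apply: is_deriveMl_fun; exact: (is_derive_expr n.+1).
apply: (@derive_dist_le _ (F n.+1) (fun x => (1 - b) `^ (alpha - 1) * x ^+ n.+1)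
  (dF n.+1) (fun x => (1 - b) `^ (alpha - 1) * (n.+1%:R * x ^+ n))).
- exact: ltW.
- exact: F_within.
- by apply: derivable_within_continuous => x _; have dx := dg x; exact: ex_derive.
- by move=> x /andP[_ xb]; apply: is_derive_F; exact: lt_trans b1.
- move=> x /andP[x0 xb]; have d1 : 0 < 1 - x by rewrite subr_gt0 (lt_trans xb).
  rewrite /dF normrN ger0_norm; last first.
    rewrite !mulr_ge0 ?powR_ge0 ?exprn_ge0 ?(ltW x0) //.
    by rewrite ltW ?binom_coef_gt0.
  have q0 : 0 <= n.+1%:R * x ^+ n by rewrite mulr_ge0 // exprn_ge0 // ltW.
  apply: ler_pM; [exact: powR_ge0| | |].
  - by rewrite mulr_ge0 //; exact/ltW/binom_coef_gt0.
  - rewrite -[alpha - 1]opprK opprB !powRN lef_pV2 ?posrE ?powR_gt0 //.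
    by apply: ge0_ler_powR; rewrite ?nnegrE ?(ltW b0) ?(ltW d0) ?(ltW d1) // lerB // ltW.
  - by rewrite ler_piMl // binom_coef_le1.
Qed.

Lemma binom_sum_cvg (b e : R) : 0 < b < 1 -> 0 < e ->
  exists N, forall n, (N <= n)%N -> 1 - e <= (1 - b) `^ alpha * binom_sum n b.
Proof.
move=> b01 e0; have /andP[bb0 b1] := b01; have d0 : 0 < 1 - b by rewrite subr_gt0.
have k0 : 0 < (1 - b) `^ (alpha - 1) by rewrite powR_gt0.
have : b ^+ n @[n --> \oo] --> 0 by apply: cvg_expr; rewrite gtr0_norm.
move=> /cvgr0_norm_le /(_ _ (divr_gt0 e0 k0)) [N _ HN].
exists N.+1 => -[//|n] nN; have := HN n.+1 (ltnW nN).
rewrite /= ger0_norm ?exprn_ge0 ?(ltW bb0) // ler_pdivlMr // mulrC => H.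
have := le_trans (F_dist n b01) H; rewrite /F; set z := _ * _; lra.
Qed.

End BinomialSeries.

(** * Lower bound for the image of a block *)

Section BinomialLower.
Variables (R : realType) (alpha : R).
Hypothesis halpha : 0 < alpha < 1.

Let a0 : 0 < alpha. Proof. by case/andP: halpha. Qed.
Let b0 : 0 < 1 - alpha. Proof. by case/andP: halpha; rewrite subr_gt0. Qed.
Let mu := @lebesgue_measure R.
Let P := binom_sum alpha.

Lemma binom_quotient_continuous n (r x : R) : 0 <= r < 1 -> 0 <= x <= 1 ->
  {for x, continuous (fun y => P n y / (1 - r * y))}.
Proof.
move=> r01 x01; have d0 : 1 - r * x != 0 by rewrite gt_eqF // denom_gt0.
exact: (is_derive_continuous (is_deriveM_fun (is_derive_binom_sum alpha n x)
  (is_deriveV_fun (f := fun y => 1 - r * y) d0 (is_derive_denom r x)))).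
Qed.

Lemma binom_quotient_integrable n (r b : R) : 0 <= r < 1 -> b <= 1 ->
  mu.-integrable `[0, b] (EFin \o (fun x => P n x / (1 - r * x))).
Proof.
move=> r01 b1; apply: continuous_compact_integrable; first exact: segment_compact.
apply: continuous_in_subspaceT => x; rewrite inE /= in_itv /= => /andP[x0 xb].
by apply: binom_quotient_continuous => //; rewrite x0 (le_trans xb).
Qed.

Let P_ge0 n (r x : R) : 0 <= r < 1 -> 0 <= x <= 1 -> 0 <= P n x / (1 - r * x).
Proof.
move=> r01 x01; rewrite divr_ge0 ?(ltW (denom_gt0 _ _)) //.
by apply: binom_sum_ge0 => //; case/andP: x01.
Qed.

(** On [0, b] the partial sum is at least a constant times (1 - x)^(-alpha), which brings back the
    kernel integral. The part over [b, 1] and the factor r^(alpha - 1) >= 1 are dropped. *)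
Lemma binom_integral_ge n (r b : R) : 0 < r < 1 -> 0 < b < 1 ->
  (1 - b) `^ alpha * P n b *
    (beta_int alpha (r / (1 - r)) - beta_int alpha (r * (1 - b) / (1 - r))) <=
  (1 - r) `^ alpha * \int[mu]_(x in `[0, 1]) (P n x / (1 - r * x)).
Proof.
move=> r01 b01; have r01' : 0 <= r < 1 by case/andP: r01 => /ltW ->.
have /andP[r0 r1] := r01; have /andP[bb0 b1] := b01.
have d0 : 0 < 1 - r by rewrite subr_gt0.
set k := (1 - b) `^ alpha * P n b.
have k0 : 0 <= k by rewrite mulr_ge0 ?powR_ge0 // binom_sum_ge0 // ltW.
set D := beta_int _ _ - _.
have D0 : 0 <= D.
  rewrite subr_ge0; apply: beta_int_le => //.
    by rewrite divr_ge0 ?mulr_ge0 ?ltW // subr_gt0.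
  by rewrite ler_pM2r ?invr_gt0 // ler_piMr ?(ltW r0) // gerBl ltW.
have I1 := binom_quotient_integrable n r01' (lexx 1).
have H : ((k * ((1 - r) `^ (- alpha) * r `^ (alpha - 1) * D))%:E <=
    \int[mu]_(x in `[0%R, 1%R]) (P n x / (1 - r * x))%:E)%E.
  apply: (@le_trans _ _ (\int[mu]_(x in `[0%R, b]) (P n x / (1 - r * x))%:E)%E).
    rewrite EFinM -hilbert_kernel_integral // -ge0_integralZl_EFin //.
    - apply: ge0_le_integral => //.
      + move=> x; rewrite /= in_itv /= => /andP[x0 xb].
        rewrite -EFinM lee_fin mulr_ge0 // hilbert_kernel_ge0 // x0 ltW //.
        exact: le_lt_trans b1.
      + apply: measurable_funeM; apply/measurable_EFinP.
        apply: measurable_funS (hilbert_kernel_measurable alpha r01') => //.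
        by move=> x; rewrite /= !in_itv /= => /andP[-> xb] /=; exact: le_lt_trans b1.
      + by case/integrableP: (binom_quotient_integrable n r01' (ltW b1)).
      + move=> x; rewrite /= in_itv /= => x0b; have /andP[x0 xb] := x0b.
        rewrite -EFinM lee_fin /hilbert_kernel mulrA ler_wpM2r //.
          by rewrite invr_ge0 ltW // denom_gt0 // x0 ltW // (le_lt_trans xb).
        exact: binom_sum_ge.
    - move=> x; rewrite /= in_itv /= => /andP[x0 xb].
      by rewrite lee_fin hilbert_kernel_ge0 // x0 ltW // (le_lt_trans xb).
    - apply/measurable_EFinP.
      apply: measurable_funS (hilbert_kernel_measurable alpha r01') => //.
      by move=> x; rewrite /= !in_itv /= => /andP[-> xb] /=; exact: le_lt_trans b1.
  apply: ge0_subset_integral => //.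
  - by case/integrableP: I1.
  - by move=> x; rewrite /= in_itv /= lee_fin => ?; exact: P_ge0.
  - by move=> x; rewrite /= !in_itv /= => /andP[-> xb] /=; rewrite (le_trans xb) // ltW.
rewrite -ler_pdivrMl ?powR_gt0 // -powRN.
move: H; rewrite -(fineK (integrable_fin_num _ I1)) // lee_fin; apply: le_trans.
rewrite mulrCA ler_wpM2l // -mulrA ler_wpM2l ?powR_ge0 // ler_peMl //.
by rewrite -opprB powRN invf_ge1 ?powR_gt0 // powR_le1 ?ltW.
Qed.

(** The partial sum is at most n, hence at most n (1 - x)^(-alpha/2). The kernel bound at exponent
    alpha/2 then costs only (1 - r)^(-alpha/2), and half of the weight is left to make the head
    negligible as r tends to 1. *)
Lemma binom_integral_le n (r : R) : 0 <= r < 1 ->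
  (1 - r) `^ alpha * \int[mu]_(x in `[0, 1]) (P n x / (1 - r * x)) <=
  n%:R * hilbert_const (alpha / 2) * (1 - r) `^ (alpha / 2).
Proof.
move=> r01; have /andP[r0 r1] := r01; have d0 : 0 < 1 - r by rewrite subr_gt0.
have h2 : 0 < alpha / 2 < 1 by case/andP: halpha => ? ?; rewrite divr_gt0 //=; lra.
have I1 := binom_quotient_integrable n r01 (lexx 1).
have H : (\int[mu]_(x in `[0%R, 1%R]) (P n x / (1 - r * x))%:E <=
   (n%:R * (hilbert_const (alpha / 2) * (1 - r) `^ (- (alpha / 2))))%:E)%E.
  rewrite -integral_itv_bndo_bndc; last first.
    case/integrableP: I1 => I1 _; apply: measurable_funS I1 => //.
    by apply: subset_itvl; rewrite bnd_simp.
  have km : measurable_fun (`[0, 1[ : set R) (EFin \o hilbert_kernel (alpha / 2) r).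
    by apply/measurable_EFinP; exact: hilbert_kernel_measurable.
  have k0 (x : R) : 0 <= x < 1 -> 0 <= hilbert_kernel (alpha / 2) r x.
    by move=> /andP[x0 x1]; rewrite hilbert_kernel_ge0 // x0 ltW.
  rewrite EFinM; apply: le_trans (lee_wpmul2l _ (hilbert_kernel_integral_le h2 r01)); last first.
    by rewrite lee_fin.
  rewrite -ge0_integralZl_EFin //.
  apply: ge0_le_integral => //.
  - move=> x; rewrite /= in_itv /= lee_fin => /andP[x0 x1].
    by rewrite P_ge0 // x0 ltW.
  - case/integrableP: I1 => I1 _; apply: measurable_funS I1 => //.
    by apply: subset_itvl; rewrite bnd_simp.
  - by apply: measurable_funeM.
  - move=> x; rewrite /= in_itv /= => /andP[x0 x1].
    have x01 : 0 <= x <= 1 by rewrite x0 ltW.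
    rewrite -EFinM lee_fin /hilbert_kernel mulrA ler_wpM2r //.
      by rewrite invr_ge0 ltW // denom_gt0.
    rewrite -[leLHS]mulr1; apply: ler_pM => //; first exact: binom_sum_ge0.
      apply: le_trans (_ : \sum_(k < n) 1 <= _); last by rewrite sumr_const card_ord.
      apply: ler_sum => k _; apply: mulr_ile1; rewrite ?exprn_ge0 ?exprn_ile1 ?(ltW x1) //.
        exact/ltW/binom_coef_gt0.
      exact: binom_coef_le1.
    rewrite powRN invf_ge1 ?powR_gt0 ?subr_gt0 //.
    by apply: powR_le1; [rewrite subr_ge0 ltW|rewrite gerBl|case/andP: h2 => /ltW].
move: H; rewrite -(fineK (integrable_fin_num _ I1)) // lee_fin => H.
apply: le_trans (ler_wpM2l (powR_ge0 _ _) H) _.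
rewrite le_eqVlt; apply/orP; left; apply/eqP.
have -> : (1 - r) `^ alpha = (1 - r) `^ (alpha / 2) * (1 - r) `^ (alpha / 2).
  by rewrite -powRD ?(gt_eqF d0) ?implybT // -splitr.
by rewrite powRN; field; rewrite gt_eqF // powR_gt0.
Qed.

(* [r] and [b] are chosen close to 1 in this order, and then [N] large. *)
Lemma binom_block_lower M (e : R) : 0 < e ->
  exists r N, [/\ 0 < r < 1, (M <= N)%N & hilbert_const alpha - e <=
   (1 - r) `^ alpha *
     (\int[mu]_(x in `[0, 1]) ((P N x - P M x) / (1 - r * x)))].
Proof.
move=> e0; set C := hilbert_const alpha.
have C0 : 0 < C := hilbert_const_gt0 halpha.
(* The four quarters of [e] pay for: the distance of T (r / (1 - r)) to its limit, the piece of T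
   lost beyond b, the head [P M], and the ratio of [P N] to the full series at b. *)
have e4 : 0 < e / 4 by rewrite divr_gt0.
have h2 : 0 < alpha / 2 < 1 by case/andP: halpha => ? ?; rewrite divr_gt0 //=; lra.
have a2 : 0 < alpha / 2 by case/andP: h2.
set K := M%:R * hilbert_const (alpha / 2).
have K0 : 0 <= K by rewrite mulr_ge0 // ltW // hilbert_const_gt0.
have [d1 d10 Hd1] := powR_small a2 (divr_gt0 e4 (ltr_wpDl K0 ltr01)).
have [d2 d20 Hd2] := powR_small a0 (divr_gt0 (mulr_gt0 e4 a0) (ltr0Sn R 1)).
(* [d1] serves the head. The bound 1/3 gives r >= 1/2, so that d / r <= 2 d <= d2, as the limit of T
   requires. *)
pose d := Num.min 3^-1 (Num.min d1 (d2 / 2)).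
have d0 : 0 < d by rewrite !lt_min d10 ?divr_gt0 ?invr_gt0 ?ltr0n.
have d3 : d <= 3^-1 by rewrite ge_min lexx.
have dd1 : d <= d1 by rewrite !ge_min lexx orbT.
have dd2 : d <= d2 / 2 by rewrite !ge_min lexx !orbT.
pose r := 1 - d.
have r01 : 0 < r < 1 by apply/andP; split; rewrite /r; lra.
have r01' : 0 <= r < 1 by case/andP: r01 => /ltW ->.
have /andP[r0 r1] := r01.
have rd : 1 - r = d by rewrite /r; ring.
have r_half : 2^-1 <= r by rewrite /r; lra.
have TC : C - e / 4 <= beta_int alpha (r / d).
  have q0 : 0 < d / r by rewrite divr_gt0.
  have q1 : d / r <= 1 by rewrite ler_pdivrMr // mul1r /r; lra.
  have qd2 : d / r <= d2.
    rewrite ler_pdivrMr //; apply: le_trans dd2 _; rewrite ler_pM2l //.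
  have := @beta_int_limit _ _ halpha (d / r); rewrite q0 q1 => /(_ isT).
  rewrite invf_div ler_norml => /andP[H _].
  have := Hd2 (d / r); rewrite q0 qd2 => /(_ isT) H2.
  have H3 : 2 * ((d / r) `^ alpha / alpha) <= e / 4.
    by rewrite mulrA ler_pdivrMr // mulrC -ler_pdivlMr.
  rewrite lerBlDr -lerBlDl; apply: le_trans H3.
  by rewrite lerNl opprB in H.
have [d4 d40 Hd4] := powR_small b0 (mulr_gt0 e4 b0).
(* The factor [d] compensates the division by 1 - r = d in the argument r h / d of T. *)
pose h := Num.min 2^-1 (d4 * d).
have h0 : 0 < h by rewrite lt_min mulr_gt0 ?invr_gt0 ?ltr0n.
have hh : h <= 2^-1 by rewrite ge_min lexx.
have hd : h <= d4 * d by rewrite ge_min lexx orbT.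
pose b := 1 - h.
have b01 : 0 < b < 1 by apply/andP; split; rewrite /b; lra.
have bh : 1 - b = h by rewrite /b; ring.
have Tb : beta_int alpha (r * h / d) <= e / 4.
  have /andP[_ H] := beta_int_bound halpha (r * h / d).
  apply: le_trans H _; rewrite ler_pdivrMr //; apply: Hd4.
  rewrite divr_gt0 ?mulr_gt0 //= ler_pdivrMr //; apply: le_trans hd.
  by rewrite ler_piMl // ltW.
have [N0 HN0] := binom_sum_cvg halpha b01 (divr_gt0 e4 C0).
exists r, (maxn M N0); split => //; first exact: leq_maxl.
set N := maxn M N0.
have /HN0 HN : (N0 <= N)%N by exact: leq_maxr.
under eq_Rintegral do rewrite mulrBl.
rewrite RintegralB //; [|exact: binom_quotient_integrable..].
rewrite mulrBr.
have L := binom_integral_ge N r01 b01.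
have U := binom_integral_le M r01'.
rewrite rd bh in L U.
have U2 : K * d `^ (alpha / 2) <= e / 4.
  have := Hd1 d; rewrite d0 dd1 => /(_ isT).
  rewrite ler_pdivlMr ?ltr_wpDl // => H; apply: le_trans H.
  by rewrite mulrC ler_wpM2l ?powR_ge0 // lerDl.
rewrite rd; apply: le_trans (lerB L (le_trans U U2)).
have TC2 : beta_int alpha (r / d) <= C.
  by apply: beta_int_le_limit => //; rewrite divr_ge0 // ltW.
have Tb0 : 0 <= beta_int alpha (r * h / d) by case/andP: (beta_int_bound halpha (r * h / d)).
have F1 : 1 - e / 4 / C <= h `^ alpha * P N b by rewrite -bh.
have F2 : h `^ alpha * P N b <= 1.
  rewrite -bh mulrC -ler_pdivlMr ?powR_gt0 ?bh // mul1r -powRN -bh.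
  by apply: binom_sum_le => //; case/andP: b01 => /ltW ->.
have eC : e / 4 / C * C = e / 4 by rewrite divfK // gt_eqF.
move: eC TC TC2 Tb Tb0 F1 F2; move: (h `^ alpha * P N b) (beta_int _ _) (beta_int _ _) (e / 4 / C).
clearbody C; move: C0 e0; clear => C0 e0 F T2 T1 q eC TC TC2 Tb Tb0 F1 F2.
(* T1 - T2 is at most C and 1 - F at most e / (4 C), so the multiplicative loss is at most e / 4. *)
have H1 : (1 - F) * (T1 - T2) <= (1 - F) * C by apply: ler_wpM2l; lra.
have H2 : (1 - F) * C <= q * C by apply: ler_wpM2r; lra.
by rewrite mulrBl mul1r in H1; lra.
Qed.

End BinomialLower.

(** * Complex-valued integrals *)

Local Open Scope complex_scope.

Section ComplexModulus.
Variable R : realType.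
Implicit Types z w : R[i].

Lemma normr_normc z : `|z| = (normc z)%:C.
Proof. by []. Qed.

Lemma normc_sqr z : normc z ^+ 2 = complex.Re z ^+ 2 + complex.Im z ^+ 2.
Proof. by case: z => a b /=; rewrite sqr_sqrtr // addr_ge0 ?sqr_ge0. Qed.

Lemma normc_Re_le z : `|complex.Re z| <= normc z.
Proof.
by rewrite -(@ler_pXn2r _ 2) ?nnegrE ?normcR_ge0 // real_normK ?num_real // normc_sqr lerDl sqr_ge0.
Qed.

Lemma normc_Im_le z : `|complex.Im z| <= normc z.
Proof.
by rewrite -(@ler_pXn2r _ 2) ?nnegrE ?normcR_ge0 // real_normK ?num_real // normc_sqr lerDr sqr_ge0.
Qed.

Lemma normc_real (x : R) : normc x%:C = `|x|.
Proof. by rewrite /= expr0n /= addr0 sqrtr_sqr. Qed.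

Lemma normc_subl_le z w : normc z - normc w <= normc (z - w).
Proof. by rewrite lerBlDr -[X in normc X <= _](subrK w z) le_normcD. Qed.

Lemma normcX z n : normc (z ^+ n) = normc z ^+ n.
Proof.
elim: n => [|n IH]; first by rewrite !expr0 normc1.
by rewrite !exprS -IH; exact: normcM.
Qed.

Lemma continuous_comp_real (phi : R[i] -> R) (G : R[i]^o -> R[i]^o) (x : R) :
  (forall z w, `|phi z - phi w| <= normc (z - w)) ->
  {for (x%:C : R[i]^o), continuous G} ->
  {for x, continuous (fun t : R => phi (G t%:C))}.
Proof.
move=> phiL cG; apply/cvgrPdist_lt => e e0.
have ec0 : 0 < e%:C :> R[i] by rewrite ltcR.
have := cG; move=> /cvgrPdist_lt /(_ _ ec0) [d /= d0 Hd].
(* A positive element of [R[i]] has zero imaginary part, so the radius is a real number. *)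
have [dr dE] : exists dr, d = dr%:C.
  by exists (complex.Re d); move: d0; rewrite ltcE => /andP[/eqP di _]; case: d di Hd => a b /= ->.
rewrite dE ltcR in d0.
exists dr => // t /= xt.
have := Hd t%:C; rewrite /= dE -rmorphB /= normr_normc normc_real ltcR => /(_ xt).
by rewrite normr_normc ltcR; apply: le_lt_trans.
Qed.

Lemma Re_lipschitz z w : `|complex.Re z - complex.Re w| <= normc (z - w).
Proof.
by rewrite -(raddfB (@complex.Re R : {additive R[i] -> R})); exact: normc_Re_le.
Qed.

Lemma Im_lipschitz z w : `|complex.Im z - complex.Im w| <= normc (z - w).
Proof.
by rewrite -(raddfB (@complex.Im R : {additive R[i] -> R})); exact: normc_Im_le.
Qed.

End ComplexModulus.

Section ComplexIntegral.
Variable R : realType.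
Let mu := @lebesgue_measure R.
Let D : set R := `[0, 1[%classic.

Let mD : measurable D. Proof. exact: measurable_itv. Qed.

(** The interval is half-open because 1 lies outside the disk, where nothing is known about
    continuity; the endpoint is a null set, so [complex_integral] is unaffected. *)
Definition cintegrable (g : R -> R[i]) : Prop :=
  mu.-integrable D (EFin \o (fun x => complex.Re (g x))) /\
  mu.-integrable D (EFin \o (fun x => complex.Im (g x))).

Lemma complex_integralE (g : R -> R[i]) : cintegrable g ->
  complex_integral 0 1 g = (\int[mu]_(x in D) complex.Re (g x)) +i*
                           (\int[mu]_(x in D) complex.Im (g x)).
Proof. by move=> [ire iim]; rewrite /complex_integral !Rintegral_itv_bndo_bndc. Qed.

Let integrable_dominated (u k : R -> R) (M : R) :
  measurable_fun D u -> measurable_fun D k ->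
  (forall x, 0 <= x < 1 -> `|u x| <= k x) ->
  (\int[mu]_(x in D) (k x)%:E <= M%:E)%E ->
  mu.-integrable D (EFin \o u).
Proof.
move=> mu_ mk uk kM; apply/integrableP; split; first exact/measurable_EFinP.
apply: le_lt_trans (ltry M); apply: le_trans kM.
apply: ge0_le_integral => //.
- by apply: measurableT_comp => //; exact/measurable_EFinP.
- exact/measurable_EFinP.
Qed.

Lemma cintegrable_dominated (g : R -> R[i]) (k : R -> R) (M : R) :
  measurable_fun D (fun x => complex.Re (g x)) ->
  measurable_fun D (fun x => complex.Im (g x)) ->
  measurable_fun D k ->
  (forall x, 0 <= x < 1 -> normc (g x) <= k x) ->
  (\int[mu]_(x in D) (k x)%:E <= M%:E)%E ->
  cintegrable g.
Proof.
move=> mre mim mk gk kM; split; apply: integrable_dominated kM => // x /gk;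
  apply: le_trans; [exact: normc_Re_le|exact: normc_Im_le].
Qed.

(** Serves twice: for both components of a complex multiple of [g], and for the projection of [g] on
    the direction of its integral. *)
Let integrable_combination (g : R -> R[i]) (a b : R) : cintegrable g ->
  mu.-integrable D (EFin \o (fun x => a * complex.Re (g x) + b * complex.Im (g x))) /\
  \int[mu]_(x in D) (a * complex.Re (g x) + b * complex.Im (g x)) =
  a * (\int[mu]_(x in D) complex.Re (g x)) + b * (\int[mu]_(x in D) complex.Im (g x)).
Proof.
move=> [ire iim].
have ia : mu.-integrable D (fun x => a%:E * (complex.Re (g x))%:E)%E.
  exact: integrableZl.
have ib : mu.-integrable D (fun x => b%:E * (complex.Im (g x))%:E)%E.
  exact: integrableZl.
split; last by rewrite -!RintegralZl // -RintegralD.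
by rewrite /comp; under eq_fun do rewrite EFinD !EFinM; exact: integrableD.
Qed.

Lemma cintegrableB (g h : R -> R[i]) : cintegrable g -> cintegrable h ->
  cintegrable (fun x => g x - h x) /\
  complex_integral 0 1 (fun x => g x - h x) =
  complex_integral 0 1 g - complex_integral 0 1 h.
Proof.
move=> ig ih; have [gr gi] := ig; have [hr hi] := ih.
have ReB x : complex.Re (g x - h x) = complex.Re (g x) - complex.Re (h x).
  exact: (raddfB (@complex.Re R : {additive R[i] -> R})).
have ImB x : complex.Im (g x - h x) = complex.Im (g x) - complex.Im (h x).
  exact: (raddfB (@complex.Im R : {additive R[i] -> R})).
have igh : cintegrable (fun x => g x - h x).
  split.
    by rewrite /comp; under eq_fun do rewrite ReB EFinB; exact: integrableB.
  by rewrite /comp; under eq_fun do rewrite ImB EFinB; exact: integrableB.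
split => //; rewrite !complex_integralE //.
under eq_Rintegral do rewrite ReB.
under [X in _ +i* X]eq_Rintegral do rewrite ImB.
by rewrite !RintegralB.
Qed.

Lemma cintegrableZ (c : R[i]) (g : R -> R[i]) : cintegrable g ->
  cintegrable (fun x => c * g x) /\
  complex_integral 0 1 (fun x => c * g x) = c * complex_integral 0 1 g.
Proof.
move=> ig; case: c => a b.
have ReZ x : complex.Re ((a +i* b) * g x) = a * complex.Re (g x) + (- b) * complex.Im (g x).
  by case: (g x) => u v /=; rewrite mulNr.
have ImZ x : complex.Im ((a +i* b) * g x) = b * complex.Re (g x) + a * complex.Im (g x).
  by case: (g x) => u v /=; rewrite addrC.
have [r1 r2] := integrable_combination a (- b) ig.
have [i1 i2] := integrable_combination b a ig.
have icg : cintegrable (fun x => (a +i* b) * g x).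
  split; first by rewrite /comp; under eq_fun do rewrite ReZ.
  by rewrite /comp; under eq_fun do rewrite ImZ.
split => //; rewrite !complex_integralE //.
under eq_Rintegral do rewrite ReZ.
under [X in _ +i* X]eq_Rintegral do rewrite ImZ.
by rewrite r2 i2 /=; congr (_ +i* _); rewrite ?mulNr // addrC.
Qed.

(* With [I = complex_integral 0 1 g], the square [|I|^2] is the integral of
   [Re (conj I * g)], which is at most [|I| |g|]. *)
Lemma normc_integral_le (g : R -> R[i]) (k : R -> R) (M : R) :
  cintegrable g -> measurable_fun D k ->
  (forall x, 0 <= x < 1 -> normc (g x) <= k x) ->
  (\int[mu]_(x in D) (k x)%:E <= M%:E)%E ->
  normc (complex_integral 0 1 g) <= M.
Proof.
move=> ig mk gk kM; rewrite (complex_integralE ig).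
set a := \int[mu]_(x in D) _; set b := \int[mu]_(x in D) _.
set n := normc (a +i* b).
have k0 x : 0 <= x < 1 -> 0 <= k x.
  by move=> /gk; apply: le_trans; exact: normcR_ge0.
have M0 : 0 <= M.
  rewrite -lee_fin; apply: le_trans kM; apply: integral_ge0 => x.
  by rewrite /D /= in_itv /= lee_fin; exact: k0.
have [n0|n0] := leP n 0; first exact: le_trans M0.
have nE : n * n = a * a + b * b by rewrite -expr2 normc_sqr /= !expr2.
rewrite -(ler_pM2l n0) nE.
have [iab <-] := integrable_combination a b ig.
rewrite /Rintegral -lee_fin fineK; last exact: integrable_fin_num.
apply: le_trans (_ : (n%:E * \int[mu]_(x in D) (k x)%:E <= _)%E); last first.
  by rewrite EFinM lee_wpmul2l // lee_fin ltW.
have ik : mu.-integrable D (EFin \o k).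
  by apply: (integrable_dominated mk mk _ kM) => x /k0 kx; rewrite ger0_norm.
rewrite -integralZl //; apply: le_integral => //; first exact: integrableZl.
move=> x; rewrite inE /D /= in_itv /= => /gk gx.
rewrite -EFinM lee_fin; apply: le_trans (ler_wpM2l (ltW n0) gx).
rewrite -[leRHS]ger0_norm ?mulr_ge0 ?normcR_ge0 //.
apply: le_trans (ler_norm _) _.
(* Cauchy-Schwarz in the plane, by Lagrange's identity: the defect is (a q - b p)^2. *)
rewrite -(@ler_pXn2r _ 2) ?nnegrE ?normr_ge0 // !real_normK ?num_real //.
rewrite exprMn !normc_sqr /=.
set p := complex.Re _; set q := complex.Im _.
have : 0 <= (a * q - b * p) ^+ 2 by exact: sqr_ge0.
lra.
Qed.

End ComplexIntegral.

(** * The Hilbert matrix operator *)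

Lemma continuous_mulc (R : realType) (f g : R[i]^o -> R[i]^o) (x : R[i]^o) :
  {for x, continuous f} -> {for x, continuous g} ->
  {for x, continuous (fun w : R[i]^o => (f w * g w : R[i]^o))}.
Proof. exact: (@continuousM R[i] R[i]^o f g). Qed.

Section HilbertOperator.
Variables (R : realType) (alpha : R).
Hypothesis halpha : 0 < alpha < 1.
Implicit Types (f : Hinf alpha) (z w : R[i]).

Let mu := @lebesgue_measure R.
Let D : set R := `[0, 1[%classic.
Let C : R := hilbert_const alpha.

Lemma Hinf_derivable f z : disk z -> derivable (f : R[i]^o -> R[i]^o) z 1.
Proof. by case: f => f /= /asboolP[fa _ _] /fa. Qed.

Lemma Hinf_continuous f z : disk z -> {for (z : R[i]^o), continuous (f : R[i]^o -> R[i]^o)}.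
Proof.
by move=> zD; apply/differentiable_continuous/derivable1_diffP/Hinf_derivable.
Qed.

Lemma disk_real (x : R) : 0 <= x < 1 -> disk x%:C.
Proof. move=> /andP[x0 x1]; change (normc x%:C < 1).
by rewrite normc_real ger0_norm. Qed.

Lemma Hinf_real_le f (x : R) : 0 <= x < 1 ->
  normc (f x%:C) <= Hinf_norm f * (1 - x) `^ (- alpha).
Proof.
move=> x01; have /andP[x0 x1] := x01.
rewrite powRN ler_pdivlMr ?powR_gt0 ?subr_gt0 //.
by have := Hinf_norm_ub f (disk_real x01); rewrite /weight normc_real ger0_norm.
Qed.

(** Stated for a general factor [K] so as to cover the Hilbert kernel, its derivative in z, and the
    remainder of its difference quotient. *)
Lemma cintegrable_Hinf f (K : R[i] -> R[i]) (k : R -> R) (M : R) :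
  (forall x, 0 <= x < 1 -> {for (x%:C : R[i]^o), continuous (K : R[i]^o -> R[i]^o)}) ->
  measurable_fun D k ->
  (forall x, 0 <= x < 1 -> normc (f x%:C * K x%:C) <= k x) ->
  (\int[mu]_(x in D) (k x)%:E <= M%:E)%E ->
  cintegrable (fun x => f x%:C * K x%:C) /\
  normc (complex_integral 0 1 (fun x => f x%:C * K x%:C)) <= M.
Proof.
move=> cK mk fk kM.
have cG (x : R) : 0 <= x < 1 ->
    {for (x%:C : R[i]^o), continuous (fun w : R[i]^o => (f w * K w : R[i]^o))}.
  move=> x01.
  exact: continuous_mulc (Hinf_continuous (f := f) (disk_real x01)) (cK x x01).
have meas (phi : R[i] -> R) : (forall z w, `|phi z - phi w| <= normc (z - w)) ->
    measurable_fun D (fun x : R => phi (f x%:C * K x%:C)).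
  move=> phiL; apply/measurable_fun_itv_obnd_cbndP.
  apply: open_continuous_measurable_fun => // x; rewrite inE /= in_itv /= => /andP[x0 x1].
  apply: (@continuous_comp_real R phi (fun w => f w * K w)) => //.
  by apply: cG; rewrite (ltW x0).
have ig : cintegrable (fun x => f x%:C * K x%:C).
  apply: (cintegrable_dominated _ _ mk fk kM).
    by apply: meas; exact: Re_lipschitz.
  by apply: meas; exact: Im_lipschitz.
by split => //; exact: normc_integral_le kM.
Qed.

(** The dominating function is a multiple of (1 - x)^(-alpha), the kernel at r = 0, whose integral
    is at most [C]. *)
Lemma cintegrable_Hinf_bounded f (K : R[i] -> R[i]) (B : R) :
  (forall x, 0 <= x < 1 -> {for (x%:C : R[i]^o), continuous (K : R[i]^o -> R[i]^o)}) ->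
  (forall x, 0 <= x < 1 -> normc (K x%:C) <= B) ->
  cintegrable (fun x => f x%:C * K x%:C) /\
  normc (complex_integral 0 1 (fun x => f x%:C * K x%:C)) <= Hinf_norm f * B * C.
Proof.
move=> cK KB.
have B0 : 0 <= B by apply: le_trans (KB 0 _); rewrite ?normcR_ge0 // lexx ltr01.
have km := hilbert_kernel_measurable alpha (introT andP (conj (lexx 0) (@ltr01 R))).
apply: (@cintegrable_Hinf f K (fun x => Hinf_norm f * B * hilbert_kernel alpha 0 x)) => //.
- exact: measurable_funM.
- move=> x x01; have -> : normc (f x%:C * K x%:C) = normc (f x%:C) * normc (K x%:C).
    exact: normcM.
  rewrite /hilbert_kernel mul0r subr0 invr1 mulr1 mulrAC.
  by apply: ler_pM; rewrite ?normcR_ge0 ?KB ?Hinf_real_le.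
- under eq_integral do rewrite EFinM.
  rewrite ge0_integralZl_EFin ?mulr_ge0 ?Hinf_norm_ge0 //.
  + have := hilbert_kernel_integral_le halpha (introT andP (conj (lexx 0) (@ltr01 R))).
    rewrite subr0 powR1 mulr1 => H.
    by rewrite [leRHS]EFinM lee_wpmul2l // lee_fin mulr_ge0 ?Hinf_norm_ge0.
  + exact: measurable_itv.
  + move=> x; rewrite /D /= in_itv /= lee_fin => /andP[x0 x1].
    by apply: hilbert_kernel_ge0; rewrite ?lexx ?ltr01 ?x0 ?ltW.
  + exact/measurable_EFinP.
Qed.

Lemma denom_normc_ge z (x : R) : 0 <= x < 1 -> 1 - normc z * x <= normc (1 - z * x%:C).
Proof.
move=> /andP[x0 x1]; apply: le_trans (normc_subl_le 1 (z * x%:C)).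
by rewrite normc1 normcM normc_real ger0_norm.
Qed.

Lemma denom_normc_ge_onem z (x : R) : disk z -> 0 <= x < 1 -> 1 - normc z <= normc (1 - z * x%:C).
Proof.
move=> zD x01; apply: le_trans (denom_normc_ge z x01); case/andP: x01 => x0 x1.
by rewrite lerB // ler_piMr ?normcR_ge0 // ltW.
Qed.

Lemma denom_neq0 z (x : R) : disk z -> 0 <= x < 1 -> 1 - z * x%:C != 0.
Proof.
move=> zD x01; apply: contraTneq (denom_normc_ge_onem zD x01) => ->.
by rewrite normc0 -ltNge subr_gt0.
Qed.

Lemma continuous_denomV z (x : R) : disk z -> 0 <= x < 1 ->
  {for (x%:C : R[i]^o), continuous (fun w : R[i]^o => ((1 - z * w)^-1 : R[i]^o))}.
Proof.
move=> zD x01; pose d : R[i]^o -> R[i]^o := fun w => 1 - z * w.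
have cd : {for (x%:C : R[i]^o), continuous d}.
  apply: (@continuousB R[i] R[i]^o R[i]^o (cst 1) (fun w => z * w)).
    exact: cst_continuous.
  by apply: (@continuous_mulc R (cst z) id); [exact: cst_continuous|move=> ?; exact].
exact: (@continuousV R[i] R[i]^o d x%:C (denom_neq0 zD x01) cd).
Qed.

Lemma hilbert_integral_cintegrable f z : disk z ->
  cintegrable (fun x => f x%:C * (1 - z * x%:C)^-1) /\
  normc (hilbert_integral f z) <= Hinf_norm f * (C * (1 - normc z) `^ (- alpha)).
Proof.
move=> zD; have z01 : 0 <= normc z < 1 by rewrite normcR_ge0.
apply: (@cintegrable_Hinf f (fun w => (1 - z * w)^-1)
  (fun x => Hinf_norm f * hilbert_kernel alpha (normc z) x)).
- by move=> x x01; exact: continuous_denomV.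
- by apply: measurable_funM => //; exact: hilbert_kernel_measurable.
- move=> x x01; have -> : normc (f x%:C * (1 - z * x%:C)^-1) =
    normc (f x%:C) * (normc (1 - z * x%:C))^-1 by rewrite -normcV; exact: normcM.
  rewrite /hilbert_kernel mulrA; apply: ler_pM;
    [exact: normcR_ge0|by rewrite invr_ge0 normcR_ge0|exact: Hinf_real_le|].
  have p1 : 0 < 1 - normc z * x.
    case/andP: x01 => x0 x1; rewrite subr_gt0; apply: le_lt_trans zD.
    by rewrite ler_piMr ?normcR_ge0 // ltW.
  by rewrite lef_pV2 ?posrE ?denom_normc_ge // (lt_le_trans p1) // denom_normc_ge.
- under eq_integral do rewrite EFinM.
  rewrite ge0_integralZl_EFin ?Hinf_norm_ge0 //.
  + by rewrite [leRHS]EFinM lee_wpmul2l ?lee_fin ?Hinf_norm_ge0 // hilbert_kernel_integral_le.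
  + exact: measurable_itv.
  + move=> x; rewrite /D /= in_itv /= lee_fin => /andP[x0 x1].
    by apply: hilbert_kernel_ge0 => //; rewrite x0 ltW.
  + by apply/measurable_EFinP; exact: hilbert_kernel_measurable.
Qed.

(** Differentiation under the integral with an exact remainder. With [V h] the kernel at z + h, V h
    - V 0 - h x (V 0)^2 equals h^2 x^2 (V 0)^2 V h, and all factors are bounded while |h| <= d / 2.
    The derivative is [G], the integral of f(x) x / (1 - z x)^2. *)
Lemma hilbert_function_derivable f z : disk z ->
  derivable (hilbert_function f : R[i]^o -> R[i]^o) z 1.
Proof.
move=> zD; have d0 : 0 < 1 - normc z by rewrite subr_gt0.
set d := 1 - normc z in d0; have zE : normc z = 1 - d by rewrite /d subKr.
pose V h w : R[i] := (1 - (z + h) * w)^-1.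
have V0E x : (1 - z * x)^-1 = V 0 x by rewrite /V addr0.
have dh h : normc h <= d / 2 -> disk (z + h).
  move=> hd; apply: (@le_lt_trans _ _ (normc z + normc h)); first exact: le_normcD.
  by rewrite zE; move: (normc h) hd => b; lra.
have d00 : disk (z + 0) by rewrite addr0.
have Vc h x : normc h <= d / 2 -> 0 <= x < 1 ->
    {for (x%:C : R[i]^o), continuous (V h : R[i]^o -> R[i]^o)}.
  by move=> /dh hD x01; exact: continuous_denomV.
have V0c x : 0 <= x < 1 -> {for (x%:C : R[i]^o), continuous (V 0 : R[i]^o -> R[i]^o)}.
  by move=> x01; exact: continuous_denomV.
have idc (x : R) : {for (x%:C : R[i]^o), continuous (id : R[i]^o -> R[i]^o)}.
  by move=> ?; exact.
have Vle h x : normc h <= d / 2 -> 0 <= x < 1 -> normc (V h x%:C) <= 2 / d.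
  move=> hd x01; rewrite /V normcV -[leRHS]invrK lef_pV2 ?posrE ?invr_gt0 ?divr_gt0 //.
    rewrite invf_div; apply: le_trans (denom_normc_ge_onem (dh h hd) x01).
    have := le_normcD z h; rewrite zE; move: (normc (z + h)) (normc h) hd => a b.
    by lra.
  by apply: lt_le_trans (denom_normc_ge_onem (dh h hd) x01); rewrite subr_gt0; exact: dh.
have h0d : normc (0 : R[i]) <= d / 2 by rewrite normc0 divr_ge0 // ltW.
pose G := complex_integral 0 1 (fun x => f x%:C * (x%:C * (V 0 x%:C * V 0 x%:C))).
have x_le (x : R) : 0 <= x < 1 -> normc x%:C <= 1.
  by move=> /andP[x0 x1]; rewrite normc_real ger0_norm // ltW.
have V2c x : 0 <= x < 1 -> {for (x%:C : R[i]^o),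
    continuous ((fun w => w * (V 0 w * V 0 w)) : R[i]^o -> R[i]^o)}.
  move=> x01; apply: continuous_mulc (idc x) _.
  by apply: continuous_mulc; exact: V0c.
have V2le x : 0 <= x < 1 -> normc (x%:C * (V 0 x%:C * V 0 x%:C)) <= 1 * (2 / d * (2 / d)).
  move=> x01; rewrite !normcM; apply: ler_pM; rewrite ?mulr_ge0 ?normcR_ge0 ?x_le //.
  by apply: ler_pM; rewrite ?normcR_ge0 ?Vle //.
have [iG _] := @cintegrable_Hinf_bounded f (fun w => w * (V 0 w * V 0 w)) _ V2c V2le.
have [i0 _] := hilbert_integral_cintegrable f d00.
pose B := Hinf_norm f * ((2 / d) * ((2 / d) * (2 / d))) * C.
have C0 : 0 < C := hilbert_const_gt0 halpha.
have B0 : 0 <= B.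
  apply: mulr_ge0; last exact: ltW.
  by rewrite !mulr_ge0 ?Hinf_norm_ge0 ?invr_ge0 ?ler0n ?(ltW d0).
have estimate h : normc h <= d / 2 ->
    normc (hilbert_integral f (z + h) - hilbert_integral f z - h * G) <= normc h ^+ 2 * B.
  move=> hd; have [ih _] := hilbert_integral_cintegrable f (dh h hd).
  pose K w := (V h w - V 0 w) - h * (w * (V 0 w * V 0 w)).
  have Kc x : 0 <= x < 1 -> {for (x%:C : R[i]^o), continuous (K : R[i]^o -> R[i]^o)}.
    move=> x01; apply: (@continuousB R[i] R[i]^o R[i]^o (fun w => V h w - V 0 w)
      (fun w => h * (w * (V 0 w * V 0 w)))).
      apply: (@continuousB R[i] R[i]^o R[i]^o (V h) (V 0)); last exact: V0c.
      exact: Vc.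
    apply: (@continuous_mulc R (cst h)); first exact: cst_continuous.
    exact: V2c.
  have KE x : 0 <= x < 1 ->
      K x%:C = h * h * (x%:C * x%:C * (V 0 x%:C * (V 0 x%:C * V h x%:C))).
    move=> x01; have := denom_neq0 d00 x01; have := denom_neq0 (dh h hd) x01.
    rewrite /K /V; move: (x%:C) => c n1 n2; field.
    by rewrite addr0 in n2; rewrite n1 n2.
  have Kle x : 0 <= x < 1 -> normc (K x%:C) <=
      normc h * normc h * (1 * 1 * (2 / d * (2 / d * (2 / d)))).
    move=> x01; rewrite KE // !normcM.
    apply: ler_wpM2l; first by rewrite mulr_ge0 ?normcR_ge0.
    apply: ler_pM; rewrite ?mulr_ge0 ?normcR_ge0 //.
      by apply: ler_pM; rewrite ?normcR_ge0 ?x_le //.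
    apply: ler_pM; rewrite ?mulr_ge0 ?normcR_ge0 ?Vle //.
    by apply: ler_pM; rewrite ?normcR_ge0 ?Vle //.
  have [_] := cintegrable_Hinf_bounded f Kc Kle.
  have -> : complex_integral 0 1 (fun x => f x%:C * K x%:C) =
      hilbert_integral f (z + h) - hilbert_integral f z - h * G.
    have [iB EB] := cintegrableB ih i0.
    have [iZ EZ] := cintegrableZ h iG.
    have [_ E] := cintegrableB iB iZ.
    transitivity (complex_integral 0 1 (fun x =>
      f x%:C * (1 - (z + h) * x%:C)^-1 - f x%:C * (1 - (z + 0) * x%:C)^-1
      - h * (f x%:C * (x%:C * (V 0 x%:C * V 0 x%:C))))).
      congr complex_integral; apply/funext => x; rewrite /K /V.
      by rewrite !mulrBr [h * (f _ * _)]mulrCA.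
    rewrite E EB EZ; congr (_ - _ - _).
    by rewrite addr0.
  move/le_trans; apply; rewrite /B expr2 le_eqVlt; apply/orP; left; apply/eqP; ring.
apply/cvg_ex; exists (G : R[i]^o).
apply/cvgrPdist_le => e e0.
have [er erE] : exists er, e = er%:C.
  by exists (complex.Re e); move: e0; rewrite ltcE => /andP[/eqP ei _]; case: e ei => a b /= ->.
rewrite {}erE ltcR in e0 *.
(* The first entry keeps z + h in the disk with |V h| <= 2 / d; the second makes the remainder,
   divided by |h|, at most [er]. *)
pose rho := Num.min (d / 2) (er / (B + 1)).
have B1 : 0 < B + 1 by rewrite ltr_wpDl.
have rho0 : 0 < rho by rewrite lt_min !divr_gt0.
have rhoC : 0 < rho%:C :> R[i] by rewrite ltcR.
near=> h.
have h0 : h != 0 by near: h; exact: nbhs_dnbhs_neq.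
have hrho : normc h <= rho.
  by rewrite -lecR -normr_normc; apply: ltW; near: h; exact: dnbhs0_lt.
have hd : normc h <= d / 2 by apply: le_trans hrho _; rewrite ge_min lexx.
have he : normc h * (B + 1) <= er.
  by rewrite -ler_pdivlMr //; apply: le_trans hrho _; rewrite ge_min lexx orbT.
rewrite /= distrC normr_normc lecR.
have n0 : 0 < normc h.
  by rewrite lt_neqAle normcR_ge0 andbT eq_sym; apply: contra_neq h0; exact: eq0_normc.
rewrite -(ler_pM2l n0).
set Q := (X in _ * normc X <= _); have -> : normc h * normc Q = normc (h * Q).
  by rewrite normcM.
have -> : h * Q = hilbert_integral f (z + h) - hilbert_integral f z - h * G.
  have FE w : disk w -> hilbert_function f w = hilbert_integral f w.
    by rewrite /hilbert_function => ->.
  have shiftE : h *: (1 : R[i]^o) + z = z + h by rewrite addrC -[h *: _]/(h * 1) mulr1.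
  rewrite /Q /= shiftE (FE _ zD) (FE _ (dh h hd)) -[_ *: _]/(_ * _).
  by rewrite mulrBr mulrA divff // mul1r.
apply: le_trans (estimate h hd) _.
rewrite expr2 -mulrA ler_pM2l //; apply: le_trans he.
by rewrite ler_wpM2l ?normcR_ge0 // lerDl.
Unshelve. all: by end_near. Qed.

Lemma hilbert_function_weight_le f z : disk z ->
  normc (hilbert_function f z) * weight alpha z <= Hinf_norm f * C.
Proof.
move=> zD; rewrite /hilbert_function; have zD' : normc z < 1 := zD.
rewrite zD'; have [_ H] := hilbert_integral_cintegrable f zD.
apply: le_trans (ler_wpM2r (weight_ge0 alpha z) H) _.
rewrite /weight powRN !mulrA divfK // gt_eqF // powR_gt0 // subr_gt0.
exact: zD.
Qed.

Lemma hilbert_function_Hinf f : hilbert_function f \in @Hinf_pred R alpha.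
Proof.
apply/asboolP; split.
- by move=> z zD; exact: hilbert_function_derivable.
- by exists (Hinf_norm f * C) => _ [z zD <-]; exact: hilbert_function_weight_le.
- by move=> z /negP zD; rewrite /hilbert_function (negbTE zD).
Qed.

Lemma hilbert_operatorE f z : disk z -> hilbert_operator f z = hilbert_integral f z.
Proof.
move=> zD; have := insubdK (0 : Hinf alpha) (hilbert_function_Hinf f).
rewrite /hilbert_operator => E.
have -> : Hinf_val (insubd (0 : Hinf alpha) (hilbert_function f)) = hilbert_function f by exact: E.
by rewrite /hilbert_function zD.
Qed.

Lemma hilbert_operator_norm_le f : Hinf_norm (hilbert_operator f) <= C * Hinf_norm f.
Proof.
apply: Hinf_norm_le => z zD; rewrite hilbert_operatorE // [leRHS]mulrC.
by have := hilbert_function_weight_le f zD; rewrite /hilbert_function zD.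
Qed.

End HilbertOperator.

(** * Blocks of the binomial series and compact operators *)

Section HinfAlgebra.
Variables (R : realType) (alpha : R).
Implicit Types f g : Hinf alpha.

Lemma HinfB f g z : (f - g) z = f z - g z.
Proof. exact: (congr1 (fun h => h z) (raddfB (\val : Hinf alpha -> _) f g)). Qed.

Lemma HinfD f g z : (f + g) z = f z + g z.
Proof. exact: (congr1 (fun h => h z) (raddfD (\val : Hinf alpha -> _) f g)). Qed.

Lemma Hinf_normE f : `|f| = (Hinf_norm f)%:C.
Proof. by []. Qed.

Lemma Hinf_norm_triangleB f g : Hinf_norm f - Hinf_norm g <= Hinf_norm (f - g).
Proof. by rewrite lerBlDr -[X in Hinf_norm X <= _](subrK g f) Hinf_norm_triangle. Qed.

Lemma Hinf_norm_distC f g : Hinf_norm (f - g) = Hinf_norm (g - f).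
Proof. by apply: complexI; rewrite -!Hinf_normE distrC. Qed.

End HinfAlgebra.

Lemma derivable_monomial (K : numFieldType) k (z : K^o) :
  derivable (fun w : K^o => (w ^+ k : K^o)) z 1.
Proof.
elim: k => [|k IH].
  by rewrite (_ : (fun _ => _) = cst (1 : K^o)).
rewrite (_ : (fun _ => _) = (fun w : K^o => w : K^o) * (fun w : K^o => w ^+ k : K^o)).
  apply: (@derivableM K K^o); [exact: derivable_id|exact: IH].
by apply/funext => w; rewrite exprS.
Qed.

Lemma derivable_monomial_sum (K : numFieldType) (c : nat -> K) n (z : K^o) :
  derivable (fun w : K^o => (\sum_(k < n) c k * w ^+ k : K^o)) z 1.
Proof.
elim: n => [|n IH].
  rewrite (_ : (fun _ => _) = cst (0 : K^o)); first exact: derivable_cst.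
  by apply/funext => w; rewrite big_ord0.
rewrite (_ : (fun _ => _) = (fun w : K^o => (\sum_(k < n) c k * w ^+ k : K^o)) +
    c n \*: (fun w : K^o => (w ^+ n : K^o))).
  by apply: derivableD; [exact: IH|apply: derivableZ; exact: derivable_monomial].
by apply/funext => w; rewrite big_ord_recr.
Qed.
Section BinomialBlocks.
Variables (R : realType) (alpha : R).
Hypothesis halpha : 0 < alpha < 1.
Let C : R := hilbert_const alpha.
Let P := binom_sum alpha.

Definition binom_csum n (z : R[i]) : R[i]^o :=
  if normc z < 1 then \sum_(k < n) (binom_coef alpha k)%:C * z ^+ k else 0.

(** With positive coefficients, the termwise triangle inequality yields exactly the same block
    evaluated at |z|. *)
Lemma binom_csumB_le m n z : (m <= n)%N -> disk z ->
  normc (binom_csum n z - binom_csum m z) <= P n (normc z) - P m (normc z).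
Proof.
move=> mn zD; have zD' : normc z < 1 := zD; rewrite /binom_csum zD'.
elim: n mn => [|n IH].
  by rewrite leqn0 => /eqP ->; rewrite !subrr normc0.
rewrite leq_eqVlt => /predU1P[->|mn]; first by rewrite !subrr normc0.
rewrite /P /binom_sum !big_ord_recr /=.
rewrite addrAC [leRHS]addrAC; apply: le_trans (le_normcD _ _) _.
apply: lerD; first exact: IH.
by rewrite normcM normcX normc_real ger0_norm // ltW // binom_coef_gt0.
Qed.

Lemma binom_csum_weight_le n z : disk z ->
  normc (binom_csum n z) * weight alpha z <= 1.
Proof.
move=> zD; have d0 : 0 < 1 - normc z by rewrite subr_gt0.
have := binom_csumB_le (leq0n n) zD.
have -> : binom_csum 0 z = 0 by rewrite /binom_csum big_ord0 if_same.
rewrite /P [binom_sum _ 0 _]big_ord0 !subr0 => H.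
rewrite /weight -ler_pdivlMr ?powR_gt0 // mul1r -powRN; apply: le_trans H _.
by apply: binom_sum_le; rewrite // normcR_ge0.
Qed.

Lemma disk_nbhs z : disk z -> \forall w \near (z : R[i]^o), disk w.
Proof.
move=> zD; have d0 : 0 < (1 - normc z)%:C :> R[i] by rewrite ltcR subr_gt0.
exists (1 - normc z)%:C => // w; rewrite /= distrC normr_normc ltcR => zw.
rewrite /disk /= -(subrK z w); apply: le_lt_trans (le_normcD _ _) _.
by rewrite -ltrBrDr.
Qed.

Lemma binom_csum_derivable n z : disk z ->
  derivable (binom_csum n : R[i]^o -> R[i]^o) z 1.
Proof.
move=> zD; apply: (near_eq_derivable _
  (@derivable_monomial_sum R[i] (fun k => (binom_coef alpha k)%:C) n z)).
by near=> w; rewrite /binom_csum ifT //; near: w; exact: disk_nbhs.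
Unshelve. all: by end_near. Qed.

Lemma binom_csum_Hinf n : binom_csum n \in @Hinf_pred R alpha.
Proof.
apply/asboolP; split.
- by move=> z zD; exact: binom_csum_derivable.
- by exists 1 => _ [z zD <-]; exact: binom_csum_weight_le.
- by move=> z /negP zD; rewrite /binom_csum (negbTE zD).
Qed.

Definition binom_elt n : Hinf alpha := MkHinf (binom_csum_Hinf n).

Lemma binom_elt_real n (x : R) : 0 <= x < 1 -> binom_elt n x%:C = (P n x)%:C.
Proof.
move=> x01; have := disk_real x01; rewrite /disk /= -/(normc x%:C) /binom_csum => ->.
rewrite /P /binom_sum rmorph_sum /=; apply: eq_bigr => k _.
by rewrite rmorphM rmorphXn.
Qed.

Lemma binom_block_weight_le m n z : (m <= n)%N -> disk z ->
  normc ((binom_elt n - binom_elt m) z) <= P n (normc z) - P m (normc z).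
Proof. by move=> mn zD; rewrite HinfB; exact: binom_csumB_le. Qed.

(** One real point [r] suffices for the lower bound: blocks are real on the axis, so the real part
    of the integral already carries the estimate. *)
Lemma hilbert_block_lower m (e : R) : 0 < e -> exists2 n, (m <= n)%N &
  C - e <= Hinf_norm (hilbert_operator (binom_elt n - binom_elt m)).
Proof.
move=> e0; have [r [n [r01 mn H]]] := binom_block_lower halpha m e0.
exists n => //; apply: le_trans H _.
have r01' : 0 <= r < 1 by case/andP: r01 => /ltW ->.
have rD := disk_real r01'.
apply: le_trans (Hinf_norm_ub _ rD); rewrite hilbert_operatorE //.
rewrite /weight normc_real ger0_norm; last by case/andP: r01'.
rewrite mulrC ler_wpM2r ?powR_ge0 //.
have [ig _] := hilbert_integral_cintegrable halpha (binom_elt n - binom_elt m) rD.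
have gE (x : R) : 0 <= x < 1 ->
    (binom_elt n - binom_elt m) x%:C / (1 - r%:C * x%:C) =
    ((P n x - P m x) / (1 - r * x))%:C.
  by move=> x01; rewrite HinfB !binom_elt_real // rmorphM rmorphB fmorphV rmorphB rmorph1 rmorphM.
rewrite /hilbert_integral complex_integralE //.
apply: le_trans (ler_norm _) _; apply: le_trans (normc_Re_le _).
set a := Rintegral _ _ (fun x => complex.Re _); rewrite /= {}/a.
rewrite -Rintegral_itv_bndo_bndc; last first.
  have In k : lebesgue_measure.-integrable (`[0, 1[%classic : set R)
      (fun x => (P k x / (1 - r * x))%:E).
    apply: integrableS (binom_quotient_integrable alpha k r01' (lexx 1)) => //.
    by apply: subset_itvl; rewrite bnd_simp.
  rewrite (_ : _ \o _ = (fun x : R => (P n x / (1 - r * x))%:E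
    - (P m x / (1 - r * x))%:E)%E); first exact: integrableB.
  by apply/funext => x /=; rewrite mulrBl EFinB.
rewrite le_eqVlt; apply/orP; left; apply/eqP; congr `|_|.
by apply: eq_Rintegral => x; rewrite inE /= in_itv /= => x01; rewrite gE.
Qed.

End BinomialBlocks.

(** * Compact operators on consecutive blocks *)

Section WeaklyNull.
Variables (R : realType) (alpha : R).
Hypothesis halpha : 0 < alpha < 1.
Let P := binom_sum alpha.
Let E := binom_elt halpha.
Variable N : nat -> nat.
Hypothesis leN : forall j, (N j <= N j.+1)%N.

Let mono i j : (i <= j)%N -> (N i <= N j)%N.
Proof. by move=> ij; apply: (homo_leq (r := leq)) ij; [exact: leqnn|exact: leq_trans|]. Qed.

Let f j : Hinf alpha := E (N j.+1) - E (N j).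

(* Distinct blocks of a power series with nonnegative coefficients add up to
   a function dominated by the whole series on the positive radius. *)
Lemma block_sum_norm_le1 (s : nat -> nat) m :
  (forall i, (s i < s i.+1)%N) -> Hinf_norm (\sum_(i < m) f (s i)) <= 1.
Proof.
move=> ls; apply: Hinf_norm_le => z zD.
have d0 : 0 < 1 - normc z by rewrite subr_gt0.
have n01 : 0 <= normc z < 1 by rewrite normcR_ge0.
have Pmono i j : (i <= j)%N -> P i (normc z) <= P j (normc z).
  move=> ij; rewrite -subr_ge0; apply: le_trans (binom_block_weight_le halpha ij zD).
  exact: normcR_ge0.
rewrite /weight -ler_pdivlMr ?powR_gt0 // mul1r -powRN.
(* The bound includes the blocks skipped between the chosen ones; these only add nonnegative terms
   at |z|. *)
have H k : normc ((\sum_(i < k) f (s i) : Hinf alpha) z) <= P (N (s k)) (normc z).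
  elim: k => [|k IH].
    rewrite big_ord0; apply: le_trans (binom_sum_ge0 halpha _ (normcR_ge0 z)).
    by rewrite [X in normc X](_ : _ = 0) ?normc0.
  rewrite big_ord_recr.
  rewrite HinfD.
  apply: le_trans (le_normcD _ _) _.
  apply: le_trans (lerD IH (binom_block_weight_le halpha (leN (s k)) zD)) _.
  by rewrite addrC subrK; apply: Pmono; apply: mono; exact: ls.
apply: le_trans (H m) _; exact: binom_sum_le.
Qed.

Lemma block_norm_le1 j : Hinf_norm (f j) <= 1.
Proof.
have := @block_sum_norm_le1 (fun i => j + i)%N 1.
rewrite big_ord_recl big_ord0 addr0 addn0; apply => i.
by rewrite addnS.
Qed.

Lemma compact_block_small (L : {linear Hinf alpha -> Hinf alpha}) (e : R) :
  compact_operator L -> 0 < e -> exists j, Hinf_norm (L (f j)) <= e.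
Proof.
move=> [U UL [cU _]] e0.
have inU g : Hinf_norm g <= 1 -> U (L g).
  by move=> g1; apply: UL; exists g => //=; rewrite Hinf_normE lecR.
have cluster_pt (u : nat -> Hinf alpha) : (forall n, U (u n)) ->
    exists g, forall d, 0 < d -> forall k, exists2 j, (k <= j)%N & Hinf_norm (u j - g) < d.
  move=> uU; have [|g [_ Hg]] := cU (u @ \oo) _.
    by exists 0%N => // n _; exact: uU.
  exists g => d d0 k.
  have dC : 0 < d%:C :> R[i] by rewrite ltcR.
  have uk : (u @ \oo) [set u j | j in [set j | (k <= j)%N]].
    by exists k => // j kj /=; exists j.
  have [_ [[j kj <-]]] := Hg _ _ uk (nbhsx_ballx g _ dC).
  rewrite -ball_normE /= Hinf_normE ltcR => gd; exists j => //.
  by rewrite Hinf_norm_distC.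
(* The cluster point will have norm at most 2 d and the chosen image lies within d of it: 3 d in
   all. *)
pose d := e / 4; have d0 : 0 < d by rewrite divr_gt0.
have [g Hg] := cluster_pt (fun j => L (f j)) (fun j => inU _ (block_norm_le1 j)).
have next k := cid2 (Hg d d0 k).
(* Each index is sought beyond the previous one, so the chosen blocks are distinct and their sums
   stay in the unit ball. *)
pose s := fix s i := if i is i'.+1 then s2val (next (s i').+1) else s2val (next 0%N).
have ls i : (s i < s i.+1)%N by exact: (s2valP (next (s i).+1)).
have sg i : Hinf_norm (L (f (s i)) - g) < d.
  by case: i => [|i]; [exact: (s2valP' (next 0%N))|exact: (s2valP' (next (s i).+1))].
pose y m := L (\sum_(i < m) f (s i)).
have yg m : Hinf_norm (y m - g *+ m) <= m%:R * d.
  elim: m => [|m IH].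
    by rewrite /y big_ord0 linear0 mulr0n subr0 mul0r Hinf_norm_le // => z _; rewrite [X in X * _]normc0 mul0r.
  rewrite /y big_ord_recr /= linearD mulrSr opprD addrACA -natr1 mulrDl mul1r.
  by apply: le_trans (Hinf_norm_triangle _ _) _; rewrite lerD // ltW.
(* A cluster point of [y] provides arbitrarily large m with y m of norm at most |h| + 1, the
   boundedness that contradicts linear growth. *)
have [h Hh] := cluster_pt y (fun m => inU _ (block_sum_norm_le1 m ls)).
(* [m |g|] is within [m d] of the bounded quantity [|y m|]. *)
have gle : Hinf_norm g <= 2 * d.
  have h1 : 0 < Hinf_norm h + 1 by rewrite ltr_wpDl ?Hinf_norm_ge0.
  have [m km ym] := Hh 1 ltr01 (Num.bound ((Hinf_norm h + 1) / d)).
  have mb : Hinf_norm h + 1 <= m%:R * d.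
    rewrite -ler_pdivrMr //; apply/ltW; apply: lt_le_trans (archi_boundP _) _.
      by rewrite divr_ge0 // ltW.
    by rewrite ler_nat.
  have m0 : 0 < m%:R :> R by rewrite -(pmulr_lgt0 _ d0); exact: lt_le_trans mb.
  have gm : Hinf_norm (g *+ m) = m%:R * Hinf_norm g.
    rewrite -scaler_nat Hinf_normZ; congr (_ * _).
    by rewrite -(rmorph_nat (real_complex R)) normc_real normr_nat.
  rewrite -(ler_pM2l m0) -gm.
  have := Hinf_norm_triangle (y m) (g *+ m - y m); rewrite addrC subrK => /le_trans; apply.
  have := Hinf_norm_triangle (y m - h) h; rewrite subrK => H.
  have := yg m; rewrite Hinf_norm_distC => Hy.
  apply: le_trans (lerD H Hy) _.
  rewrite (_ : m%:R * (2 * d) = m%:R * d + m%:R * d) ?lerD2r; last by ring.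
  by apply: le_trans mb; rewrite addrC lerD2l ltW.
exists (s 0%N).
have := Hinf_norm_triangle (L (f (s 0%N)) - g) g; rewrite subrK => /le_trans; apply.
apply: le_trans (lerD (ltW (sg 0%N)) gle) _; rewrite /d; lra.
Qed.

End WeaklyNull.

(** * Norm and essential norm *)

Section Norms.
Variables (R : realType) (alpha : R).
Hypothesis halpha : 0 < alpha < 1.
Let X := Hinf alpha.
Let H : X -> X := @hilbert_operator R alpha.
Let C : R := hilbert_const alpha.

Lemma op_norm_hilbert_le : (op_norm H <= C%:E)%E.
Proof.
apply: ge_ereal_sup => _ [f /= f1 <-]; rewrite lee_fin.
rewrite Hinf_normE lecR in f1; change (Hinf_norm (H f) <= C).
apply: le_trans (hilbert_operator_norm_le halpha f) _.
by rewrite ler_piMr // ltW // hilbert_const_gt0.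
Qed.

Lemma compact_operator0 : compact_operator (\0 : {linear X -> X}).
Proof.
exists [set 0]; first by move=> _ [f _ <-].
split; first exact: compact_set1.
by apply: compact_closed; [exact: norm_hausdorff|exact: compact_set1].
Qed.

Lemma essential_le_op_norm : (essential_norm H <= op_norm H)%E.
Proof.
apply: ereal_inf_lbound; exists (\0 : {linear X -> X}); first exact: compact_operator0.
by congr op_norm; apply/funext => f; rewrite subr0.
Qed.

Lemma essential_norm_hilbert_ge : (C%:E <= essential_norm H)%E.
Proof.
apply: le_ereal_inf_tmp => _ [L cL <-].
apply/lee_addgt0Pr => e e0.
have e2 : 0 < e / 2 by rewrite divr_gt0.
have step m := cid2 (hilbert_block_lower halpha m e2).
(* Every block starts where the previous one ends, and every one nearly attains the constant.
   Whichever block [L] makes small, its image under [H] is therefore large. *)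
pose N := fix N j := if j is j'.+1 then s2val (step (N j')) else 0%N.
have leN j : (N j <= N j.+1)%N by exact: (s2valP (step (N j))).
have [j Lj] := compact_block_small halpha leN cL e2.
have Hj := s2valP' (step (N j)).
set f := binom_elt halpha (N j.+1) - binom_elt halpha (N j) in Lj.
have f1 : Hinf_norm f <= 1 := block_norm_le1 halpha leN j.
apply: (@le_trans _ _ ((Hinf_norm (H f - L f))%:E + e%:E)%E); last first.
  rewrite leeD2r //; apply: ereal_sup_ubound; exists f => //=.
  by rewrite Hinf_normE lecR.
rewrite -EFinD lee_fin.
have := Hinf_norm_triangleB (H f) (L f).
move: Lj Hj; rewrite -/f -/C -/H.
move: (Hinf_norm _) (Hinf_norm _) (Hinf_norm _) => a b c; lra.
Qed.

End Norms.

Theorem theorem9p2 (R : realType) (alpha : R) (halpha : 0 < alpha < 1) :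
  [/\ (forall (f : Hinf alpha) (z : R[i]%C), disk z ->
         hilbert_operator f z = hilbert_integral f z),
      op_norm (@hilbert_operator R alpha) = (pi / sin (alpha * pi))%:E
    & essential_norm (@hilbert_operator R alpha)
      = (pi / sin (alpha * pi))%:E].
Proof.
have le1 := op_norm_hilbert_le halpha.
have le2 := @essential_le_op_norm R alpha.
have le3 := essential_norm_hilbert_ge halpha.
split; first by move=> f z; exact: hilbert_operatorE.
  by apply/le_anti; rewrite le1 (le_trans le3 le2).
by apply/le_anti; rewrite le3 (le_trans le2 le1).
Qed.
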